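(* Let $0<1/n\ll 1/\ell\ll\varepsilon\ll\gamma\ll 1/r$, where $n,\ell,r\in\mathbb N$, and let $T\in\mathcal T_r$ for some $r\ge 3$. Suppose that $G$ is a digraph on $n$ vertices with $\delta^0(G)\ge (1-1/r-\varepsilon)n$. Then at least one of the following holds: (i) $G$ contains a $T$-packing that covers all but at most $\ell$ vertices; (ii) $G$ contains a $\gamma$-independent set of size at least $n/r$.
   Context: Hierarchy notation: $0<a\ll b\ll c$ means the constants are chosen from right to left, each sufficiently small in terms of those to its right (there are increasing functions $f,g$ such that the statement holds whenever $b\le f(c)$ and $a\le g(b)$); longer hierarchies are analogous. A digraph has no loops and at most one edge in each direction between any two vertices; $\delta^0(G)$ is the minimum of the minimum out- and indegree. $\mathcal T_r$ is the set of tournaments on $r$ vertices. A $T$-packing is a collection of vertex-disjoint (not necessarily induced) copies of $T$ in $G$. For $G$ on $n$ vertices, $S\subseteq V(G)$ is $\gamma$-independent if $G[S]$ has at most $\gamma n^2$ edges. *)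

(* Defs.v *)
From mathcomp Require Import all_boot all_order all_algebra.
From mathcomp Require Import reals.

Set Implicit Arguments.
Unset Strict Implicit.
Unset Printing Implicit Defensive.

Import Order.TTheory GRing.Theory Num.Theory.
Local Open Scope ring_scope.

(* The functions that bound the constants in a hierarchy a << b << c << ...:
   only their values on positive arguments matter. *)
Definition hierarchy_fun (R : realType) (f : R -> R) : Prop :=
  (forall x, 0 < x -> 0 < f x) /\ (forall x y, 0 < x -> x < y -> f x < f y).

(* A relation on the vertices already has at most one edge in each direction
   between two vertices; only loops have to be excluded. *)
Record digraph := Digraph {
  vertex :> finType;
  edge : rel vertex;
  edge_irr : irreflexive edge
}.

Definition num_vertices (G : digraph) : nat := #|[set: G]|.

Definition outdeg (G : digraph) (x : G) : nat := #|[set y | edge x y]|.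
Definition indeg (G : digraph) (x : G) : nat := #|[set y | edge y x]|.

(* The default value num_vertices G exceeds every degree, so it plays a role only when
   G has no vertices. *)
Definition min_semidegree (G : digraph) : nat :=
  \big[minn/num_vertices G]_(x : G) minn (outdeg x) (indeg x).

Definition is_tournament (T : digraph) : Prop :=
  forall x y : T, x != y -> edge x y (+) edge y x.

(* Copies of T in G are given by embeddings; they need not be induced. *)
Definition is_copy (T G : digraph) (f : {ffun T -> G}) : Prop :=
  injective f /\ (forall x y, edge x y -> edge (f x) (f y)).

Definition copy_vertices (T G : digraph) (f : {ffun T -> G}) : {set G} :=
  [set f x | x : T].

Definition is_packing (T G : digraph) (P : {set {ffun T -> G}}) : Prop :=
  (forall f, f \in P -> is_copy f) /\
  (forall f g, f \in P -> g \in P -> f != g ->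
     [disjoint copy_vertices f & copy_vertices g]).

Definition covered (T G : digraph) (P : {set {ffun T -> G}}) : {set G} :=
  \bigcup_(f in P) copy_vertices f.

Definition induced_edges (G : digraph) (S : {set G}) : {set G * G} :=
  [set e | [&& e.1 \in S, e.2 \in S & edge e.1 e.2]].

Definition gamma_independent (R : realType) (gamma : R) (G : digraph)
    (S : {set G}) : Prop :=
  (#|induced_edges S|%:R : R) <= gamma * (num_vertices G)%:R ^+ 2.

(* Main.v *)
(* Take a largest T-packing and suppose that it leaves many (but boundedly many
   suffice) vertices uncovered. Group the rest of the graph into blocks of r
   vertices, where every tile is a block, and sample an uncovered vertex x and s
   blocks, s a large constant. With high probability the graph H spanned by the
   sample, with x repeated r times, inherits the degree condition and contains no
   independent set of size close to |H|/r; the latter uses that such a set almost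
   equals the non-neighbourhood of each of its vertices. By Farkas' lemma H then
   has a perfect fractional T-tiling: a weight function that is nonnegative on all
   copies of T has nonnegative sum, as one sees by embedding T greedily into the
   vertices of smallest weight, and by finding a copy of j+1 vertices of T in the
   j|H|/r lightest vertices where the weights jump most.
   Let D be a common denominator of these tilings for all possible H. By the
   pigeonhole principle and the box theorem for s-partite hypergraphs, G contains
   the D-fold blow-up of one such H, whose row of copies of x consists of
   uncovered vertices. It has a perfect T-tiling, by (s+1)D tiles, and these
   replace at most sD tiles of the packing, a contradiction. *)

Require Import Defs.
From mathcomp Require Import all_boot all_order all_algebra.
From mathcomp Require Import reals boolp sequences exp ring lra zify.

Set Implicit Arguments.
Unset Strict Implicit.
Unset Printing Implicit Defensive.

Import Order.TTheory GRing.Theory Num.Theory.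
Local Open Scope ring_scope.

(** * Farkas' lemma *)

(** Sampling whole blocks keeps the number of destroyed tiles down: the blow-up spans [r * s * D]
    vertices of blocks, but these come from only [s * D] blocks. The [r] clones of [x] make the
    uncovered row as wide as a block, so the new tiling is ahead by at least the [D] tiles that this
    row is worth. The obstacle is that a sample keeps the degrees only up to an error [e], while its
    fractional tiling has to be perfect. With non-neighbourhoods of up to [m + e] vertices in a host
    of order [r * m], greedy embedding loses an amount proportional to [e], and the jump of the
    weights has to regain it. All losses are linear in [e], so [s] can be a fixed multiple of [e],
    and the constants can be fixed before any graph is given. *)

(** Induction on the number of vectors. If the functional [y] found for the first [n] vectors is
    negative on [a n], everything is projected along [a n] onto the kernel of [y], where the
    induction hypothesis applies again. *)
Lemma farkas (F : realFieldType) (C : finType) (n : nat) (a : nat -> C -> F)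
    (b : C -> F) :
  (exists x : nat -> F, (forall i, 0 <= x i) /\
     forall c, b c = \sum_(i < n) x i * a i c) \/
  (exists y : C -> F, (forall i, (i < n)%N -> 0 <= \sum_c a i c * y c) /\
     \sum_c b c * y c < 0).
Proof.
elim: n a b => [|n IHn] a b.
  have [/forallP b0|/forallPn[c0 bc0]] := boolP [forall c, b c == 0].
    left; exists (fun=> 0); split=> // c.
    by rewrite big_ord0; apply/eqP.
  right; exists (fun c => - b c); split=> //.
  rewrite (bigD1 c0) //= ltr_wnDr //.
    by apply: sumr_le0 => c _; rewrite mulrN oppr_le0 -expr2 sqr_ge0.
  by rewrite mulrN oppr_lt0 -expr2 exprn_even_gt0.
have [[x [x0 bx]]|[y [ay by0]]] := IHn a b.
  left; exists (fun i => if i == n then 0 else x i); split.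
    by move=> i; case: eqP.
  move=> c; rewrite big_ord_recr /= eqxx mul0r addr0 bx.
  by apply: eq_bigr => i _; rewrite ltn_eqF.
have [any|any] := lerP 0 (\sum_c a n c * y c).
  right; exists y; split=> // i; rewrite ltnS leq_eqVlt => /orP[/eqP->//|].
  exact: ay.
set p := \sum_c a n c * y c in any.
pose l (u : C -> F) := (\sum_c u c * y c) / p.
have [[x [x0 bx]]|[z [az bz]]] :=
    IHn (fun i c => a i c - l (a i) * a n c) (fun c => b c - l b * a n c).
  (* Both [b] and [a n] are negative on [y], so [l b] is positive, while every [l (a i)] is at most
     0; hence the coefficient of [a n] is nonnegative. *)
  left; exists (fun i => if (i < n)%N then x i else
                  l b - \sum_(i < n) x i * l (a i)); split.
    move=> i; case: ifP => // _.
    rewrite subr_ge0; apply: (@le_trans _ _ 0).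
      apply: sumr_le0 => k _; rewrite mulr_ge0_le0 //.
      by rewrite mulr_ge0_le0 ?invr_le0 ?ay // ltW.
    by rewrite ltW // /l nmulr_rgt0 // invr_lt0.
  move=> c; rewrite big_ord_recr /= ltnn.
  under eq_bigr => i _ do rewrite ltn_ord.
  have := bx c; under [X in _ = X -> _]eq_bigr => i _ do rewrite mulrBr mulrA.
  rewrite sumrB -mulr_suml => /eqP; rewrite subr_eq => /eqP ->; ring.
pose t := (\sum_c a n c * z c) / p.
have dot u : \sum_c u c * (z c - t * y c) =
    \sum_c (u c - l u * a n c) * z c.
  under eq_bigr => c _ do rewrite mulrBr mulrCA.
  under [RHS]eq_bigr => c _ do rewrite mulrBl -mulrA.
  rewrite !sumrB -!mulr_sumr; congr (_ - _); rewrite /t /l; ring.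
right; exists (fun c => z c - t * y c); split; last by rewrite dot.
move=> i; rewrite ltnS leq_eqVlt => /orP[/eqP->|/az]; rewrite dot //.
rewrite big1 // => c _; rewrite /l divff ?mul1r ?subrr ?mul0r //.
by rewrite lt_eqF.
Qed.

Lemma clear_denominators (I : finType) (x : I -> rat) :
  (forall i, 0 <= x i) ->
  exists (D : nat) (y : I -> nat), (0 < D)%N /\
    forall i, (y i)%:R = D%:R * x i :> rat.
Proof.
move=> x0; pose d i := `|denq (x i)|%N.
have d0 i : (0 < d i)%N by rewrite /d absz_gt0 denq_neq0.
exists (\prod_i d i)%N, (fun i => `|numq (x i)| * \prod_(j | j != i) d j)%N.
split; first by rewrite prodn_gt0.
move=> i /=; rewrite [X in _ = X%:R * _](bigD1 i) //= !natrM mulrAC.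
congr (_ * _).
rewrite /d !natr_absz ger0_norm ?numq_ge0 // gtr0_norm ?denq_gt0 //.
by rewrite mulrC numqE.
Qed.

(** * Greedy embedding of tournaments *)

Local Open Scope nat_scope.

(** Natural numbers as labels let a copy of the first [k] vertices be prolonged. Injectivity is not
    demanded: in a loopless host the edges of a tournament enforce it. *)
Definition partial_copy (C : finType) (E : rel C) (T : rel nat)
    (g : nat -> C) (k : nat) : Prop :=
  forall i j, i < k -> j < k -> T i j -> E (g i) (g j).

Definition candidates (C : finType) (E : rel C) (T : rel nat)
    (g : nat -> C) (k l : nat) : {set C} :=
  [set c | [forall i : 'I_k, (T i l ==> E (g i) c) && (T l i ==> E c (g i))]].

Definition nonout (C : finType) (E : rel C) (x : C) : {set C} :=
  [set y | ~~ E x y].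

Definition nonin (C : finType) (E : rel C) (x : C) : {set C} :=
  [set y | ~~ E y x].

Definition tournament_on (T : rel nat) (r : nat) : Prop :=
  (forall i, ~~ T i i) /\
  (forall i j, i < r -> j < r -> i != j -> T i j (+) T j i).

Lemma card_bigcup_le (I C : finType) (P : pred I) (F : I -> {set C}) :
  #|\bigcup_(i | P i) F i| <= \sum_(i | P i) #|F i|.
Proof.
elim/big_rec2: _ => [|i n A _ le_An]; first by rewrite cards0.
by apply: leq_trans (leq_card_setU _ _) _; rewrite leq_add2l.
Qed.

(** Only one direction occurs between [l] and an earlier label, so each earlier vertex rules out a
    single non-neighbourhood. *)
Lemma card_candidates (C : finType) (E : rel C) (T : rel nat) (r M : nat)
    (g : nat -> C) (k l : nat) :
  tournament_on T r ->
  (forall c, #|nonout E c| <= M) -> (forall c, #|nonin E c| <= M) ->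
  k <= l -> l < r -> #|~: candidates E T g k l| <= k * M.
Proof.
move=> [_ Txor] Hout Hin kl lr.
have -> : k * M = \sum_(i < k) M by rewrite sum_nat_const card_ord.
pose F (i : 'I_k) := if T i l then nonout E (g i) else nonin E (g i).
apply: leq_trans (_ : #|\bigcup_i F i| <= _).
  apply: subset_leq_card; apply/subsetP => c; rewrite !inE negb_forall.
  move=> /existsP[i]; rewrite negb_and => h; apply/bigcupP; exists i => //.
  have il : i < l by apply: leq_trans kl.
  have := Txor i l (ltn_trans il lr) lr (negbT (ltn_eqF il)).
  by rewrite /F; move: h; case: (T i l); case: (T l i); rewrite //= !inE ?orbF.
apply: (leq_trans (card_bigcup_le _ _)); apply: leq_sum => i _.
by rewrite /F; case: ifP.
Qed.

Lemma greedy_copy (C : finType) (E : rel C) (T : rel nat) (r M : nat)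
    (A : nat -> {set C}) (g : nat -> C) (k L : nat) :
  tournament_on T r ->
  (forall c, #|nonout E c| <= M) -> (forall c, #|nonin E c| <= M) ->
  k <= L -> L <= r -> partial_copy E T g k ->
  (forall i, k <= i < L -> i * M < #|A i|) ->
  exists g', [/\ partial_copy E T g' L, forall i, i < k -> g' i = g i
    & forall i, k <= i < L -> g' i \in A i].
Proof.
move=> Ttour Hout Hin; elim: L => [|L IHL].
  rewrite leqn0 => /eqP-> _ _ _; exists g; split=> // i; lia.
rewrite leq_eqVlt => /orP[/eqP-> _ gk _|kL Lr gk AM].
  by exists g; split=> // i; lia.
rewrite ltnS in kL; have [|g' [g'L g'k g'A]] := IHL kL (ltnW Lr) gk.
  by move=> i /andP[ki iL]; apply: AM; lia.
have [c] : exists c, c \in A L :&: candidates E T g' L L.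
  apply/set0Pn; rewrite -card_gt0.
  have := AM L; rewrite kL leqnn => /(_ isT).
  have := card_candidates g' Ttour Hout Hin (leqnn L) Lr.
  rewrite -(cardsID (candidates E T g' L L) (A L)) setDE.
  have := subset_leq_card (subsetIr (A L) (~: candidates E T g' L L)).
  lia.
rewrite inE => /andP[cA]; rewrite inE => /forallP cc.
exists (fun i => if i == L then c else g' i); split.
- move=> i j; rewrite !ltnS => iL jL Tij.
  case: eqP iL Tij => [->|/eqP iL] iL'; case: eqP jL => [->|/eqP jL] jL'.
  + by rewrite (negbTE (Ttour.1 L)).
  + have jl : j < L by lia.
    by move=> TLj; have /andP[_] := cc (Ordinal jl); rewrite TLj.
  + have il : i < L by lia.
    by move=> TiL; have /andP[+ _] := cc (Ordinal il); rewrite TiL.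
  + by apply: g'L; lia.
- move=> i ik; rewrite ifF; first exact: g'k.
  by apply: ltn_eqF; apply: leq_trans kL.
- move=> i /andP[ki]; rewrite ltnS leq_eqVlt; case: eqP => [->//|_] /= iL.
  by apply: g'A; rewrite ki.
Qed.

(** Missing out-edges and missing in-edges have the same total, so by averaging some [v] lacks few
    in-edges as well. Its at most [2 * rho] non-neighbours are deleted and the argument is
    iterated. *)
Lemma complete_in_dense (C : finType) (E : rel C) (k rho : nat) (D : {set C}) :
  (forall a, a \in D -> #|D :&: nonout E a| <= rho) -> 2 * rho * k < #|D| ->
  exists g : nat -> C, (forall i, i <= k -> g i \in D) /\
    forall i j, i <= k -> j <= k -> i != j -> E (g i) (g j).
Proof.
elim: k D => [|k IHk] D Drho Dlarge.
  have [c cD] : exists c, c \in D by apply/set0Pn; rewrite -card_gt0; lia.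
  by exists (fun=> c); split=> // -[|i] [|j].
have [v vD vin] : exists2 v, v \in D & #|D :&: nonin E v| <= rho.
  apply/exists_inP; apply: contraT.
  rewrite negb_exists_in => /forall_inP vin; exfalso.
  have sw : \sum_(a in D) #|D :&: nonout E a| = \sum_(v in D) #|D :&: nonin E v|.
    under eq_bigr => a _ do rewrite -sum1_card.
    under [RHS]eq_bigr => a _ do rewrite -sum1_card.
    rewrite (exchange_big_dep (mem D)) /=; last by move=> a b _ /setIP[].
    apply: eq_bigr => b bD; apply: eq_bigl => a.
    by rewrite !inE bD.
  have [D0|[v0 v0D]] := set_0Vmem D.
    by move: Dlarge; rewrite D0 cards0.
  have : \sum_(v in D) #|D :&: nonin E v| > \sum_(v in D) rho.
    rewrite (bigD1 v0) //= [X in _ < X](bigD1 v0) //= -addSn leq_add //.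
      by rewrite ltnNge; apply: vin.
    by apply: leq_sum => v /andP[vD _]; rewrite ltnW // ltnNge; apply: vin.
  by rewrite -sw ltnNge leq_sum.
have vout := Drho v vD.
pose D' := D :\: (nonout E v :|: nonin E v).
have [||g [gD gE]] := IHk D'.
- move=> a /setDP[aD _]; apply: leq_trans (Drho a aD).
  by apply: subset_leq_card; apply: setSI; apply: subsetDl.
- have := cardsD D (nonout E v :|: nonin E v); rewrite -/D' setIUr.
  have := leq_card_setU (D :&: nonout E v) (D :&: nonin E v) => -[leU _].
  nia.
have gv i : i <= k -> [/\ g i \in D, E v (g i) & E (g i) v].
  by move=> /gD; rewrite !inE negb_or !negbK => /andP[/andP[-> ->] ->].
exists (fun i => if i is i'.+1 then g i' else v); split.
  by case=> [|i] //; rewrite ltnS => /gv[].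
case=> [|i] [|j] //.
- by rewrite ltnS => _ /gv[].
- by rewrite ltnS => /gv[].
- by rewrite !ltnS eqSS; apply: gE.
Qed.

(* If no edge goes from A to B and B has nearly M vertices, then B is nearly the
   whole non-outneighbourhood of each vertex of A, so A \ B is nearly complete. *)
Lemma dense_or_independent (C : finType) (E : rel C) (M rho k : nat)
    (A B : {set C}) :
  (forall c, #|nonout E c| <= M) ->
  (forall a b, a \in A -> b \in B -> ~~ E a b) ->
  M <= #|B| + rho ->
  (exists g : nat -> C, (forall i, i <= k -> g i \in A) /\
    forall i j, i <= k -> j <= k -> i != j -> E (g i) (g j)) \/
  #|A| <= #|A :&: B| + 2 * rho * k.
Proof.
move=> Hout AB MB.
have [AD|AD] := ltnP (2 * rho * k) #|A :\: B|; last first.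
  by right; rewrite -(cardsID B A) leq_add2l.
left; have [|g [gA gE]] := @complete_in_dense _ E k rho _ _ AD.
  move=> a /setDP[aA _].
  have : #|B :|: (A :\: B) :&: nonout E a| <= M.
    apply: leq_trans (Hout a); apply: subset_leq_card; apply/subsetP => b.
    by rewrite !inE => /orP[/AB->//|/andP[]].
  rewrite cardsU (_ : B :&: _ = set0) ?cards0; first lia.
  by apply/setP => b; rewrite !inE; case: (b \in B).
by exists g; split=> // i /gA /setDP[].
Qed.

(** Greedy embedding into about [j * m] vertices places only [j] labels, one too few. All but the
    last two labels are placed greedily, which leaves sets [A] and [B] of at least almost [m]
    candidates for these two. An edge between them in the direction of [T] completes the copy.
    Without one, [dense_or_independent] gives a complete digraph, which contains the tournament, or
    a large overlap of [A] and [B], which is independent. *)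
Lemma copy_in_large_set (C : finType) (E : rel C) (T : rel nat)
    (r m e d j : nat) (S : {set C}) :
  tournament_on T r ->
  (forall c, #|nonout E c| <= m + e) -> (forall c, #|nonin E c| <= m + e) ->
  0 < j -> j < r -> d + r * e < m -> j * m <= #|S| + d ->
  (exists g, partial_copy E T g j.+1 /\ forall i, i <= j -> g i \in S) \/
  (exists I : {set C}, (forall a b, a \in I -> b \in I -> ~~ E a b) /\
     m <= #|I| + (2 * r + 1) * (d + r * e)).
Proof.
(* From here [j] is one less than in the statement: labels below [j] are placed greedily, and the
   last two are [j] and [j.+1]. *)
case: j => // j Ttour Hout Hin _ jr dm Sd.
have [c cS] : exists c, c \in S by apply/set0Pn; rewrite -card_gt0; nia.
have [|//|||g [gj _ gS]] := greedy_copy (g := fun=> c) (A := fun=> S) (k := 0)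
    (L := j) Ttour Hout Hin _ _ _ _ => //; first lia.
  by move=> i /andP[_ ij]; nia.
have xT := Ttour.2 j j.+1 ltac:(lia) jr ltac:(lia).
pose A := S :&: candidates E T g j j.
pose B := S :&: candidates E T g j j.+1.
have cardS l : j <= l -> l < r ->
    #|S| <= #|S :&: candidates E T g j l| + j * (m + e).
  move=> jl lr; have := card_candidates g Ttour Hout Hin jl lr.
  rewrite -(cardsID (candidates E T g j l) S) setDE.
  have := subset_leq_card (subsetIr S (~: candidates E T g j l)); lia.
have cA := cardS j (leqnn j) (ltn_trans (ltnSn j) jr).
have cB := cardS j.+1 (leqnSn j) jr.
rewrite -/A in cA; rewrite -/B in cB.
have rho1 : m + e <= #|B| + (d + r * e) by nia.
have rho2 : m + e <= #|A| + (d + r * e) by nia.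
have ext a b : a \in A -> b \in B -> (T j j.+1 -> E a b) ->
    (T j.+1 j -> E b a) ->
    exists g, partial_copy E T g j.+2 /\ forall i, i <= j.+1 -> g i \in S.
  move=> /setIP[aS]; rewrite inE => /forallP ca /setIP[bS].
  rewrite inE => /forallP cb Eab Eba.
  have gA i : i < j -> (T i j ==> E (g i) a) && (T j i ==> E a (g i)).
    by move=> ij; apply: (ca (Ordinal ij)).
  have gB i : i < j -> (T i j.+1 ==> E (g i) b) && (T j.+1 i ==> E b (g i)).
    by move=> ij; apply: (cb (Ordinal ij)).
  exists (fun i => if i == j then a else if i == j.+1 then b else g i); split.
    move=> i i' ij ij'.
    have [->|ni] := eqVneq i j; have [->|ni'] := eqVneq i' j.
    - by rewrite (negbTE (Ttour.1 j)).
    - have [->//|nj'] := eqVneq i' j.+1.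
      by have /gA/andP[_ /implyP] : i' < j by lia.
    - have [->//|nj] := eqVneq i j.+1.
      by have /gA/andP[/implyP] : i < j by lia.
    - have [->|nj] := eqVneq i j.+1; have [->|nj'] := eqVneq i' j.+1.
      + by rewrite (negbTE (Ttour.1 j.+1)).
      + by have /gB/andP[_ /implyP] : i' < j by lia.
      + by have /gB/andP[/implyP] : i < j by lia.
      + by apply: gj; lia.
  move=> i ij; case: eqP => // ni; case: eqP => // nj.
  by apply: gS; lia.
have complete_copy g' : (forall i, i <= j.+1 -> g' i \in S) ->
    (forall i i', i <= j.+1 -> i' <= j.+1 -> i != i' -> E (g' i) (g' i')) ->
    exists g, partial_copy E T g j.+2 /\ forall i, i <= j.+1 -> g i \in S.
  move=> g'S g'E; exists g'; split=> // i i' ij ij' Tii'; apply: g'E => //.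
  by apply: contraTneq Tii' => ->; apply: Ttour.1.
(* A and B differ because the last two labels may see the first j - 1 ones in
   different directions. *)
have final : (exists g, partial_copy E T g j.+2 /\
      forall i, i <= j.+1 -> g i \in S) \/
    (forall a b, a \in A :&: B -> b \in A :&: B -> ~~ E a b) /\
    (#|A| <= #|A :&: B| + 2 * (d + r * e) * j.+1 \/
     #|B| <= #|A :&: B| + 2 * (d + r * e) * j.+1).
  have [Tj|Tj] := boolP (T j j.+1).
    have Tj' : ~~ T j.+1 j by rewrite Tj in xT.
    have [/exists_inP[a aA /exists_inP[b bB Eab]]|noE] :=
        boolP [exists a in A, exists b in B, E a b].
      by left; apply: (ext a b) => //; rewrite (negbTE Tj').
    have AB a b : a \in A -> b \in B -> ~~ E a b.
      move=> aA bB; apply: contra noE => Eab.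
      by apply/exists_inP; exists a => //; apply/exists_inP; exists b.
    have [[g' [g'A g'E]]|card_AB] := dense_or_independent j.+1 Hout AB rho1.
      by left; apply: complete_copy g'E => i /g'A/setIP[].
    by right; split; [move=> a b /setIP[aA _] /setIP[_]; apply: AB | left].
  have Tj' : T j.+1 j by move: xT; rewrite (negbTE Tj).
  have [/exists_inP[b bB /exists_inP[a aA Eba]]|noE] :=
      boolP [exists b in B, exists a in A, E b a].
    by left; apply: (ext a b) => //; rewrite (negbTE Tj).
  have BA b a : b \in B -> a \in A -> ~~ E b a.
    move=> bB aA; apply: contra noE => Eba.
    by apply/exists_inP; exists b => //; apply/exists_inP; exists a.
  have [[g' [g'B g'E]]|card_BA] := dense_or_independent j.+1 Hout BA rho2.
    by left; apply: complete_copy g'E => i /g'B/setIP[].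
  right; split; first by move=> b a /setIP[_ bB] /setIP[aA _]; apply: BA.
  by right; rewrite setIC.
case: final => [|[indep cardI]]; first by left.
right; exists (A :&: B); split=> //.
have : 2 * (d + r * e) * j.+1 <= 2 * r * (d + r * e) by nia.
by case: cardI; lia.
Qed.

Local Open Scope ring_scope.

(** * Perfect fractional tilings *)

Lemma sorted_weights (C : finType) (w : C -> rat) :
  exists u : nat -> rat,
    [/\ forall i j, (i <= j)%N -> (j < #|C|)%N -> u i <= u j,
        \sum_c w c = \sum_(0 <= i < #|C|) u i
      & forall i, (i < #|C|)%N -> (i < #|[set c | (w c <= u i)%R]|)%N].
Proof.
pose s := sort <=%R (map w (enum C)).
have size_s : size s = #|C| by rewrite size_sort size_map -cardE.
have mono i j : (i <= j)%N -> (j < #|C|)%N -> nth 0 s i <= nth 0 s j.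
  move=> ij jC; apply: (sorted_leq_nth le_trans lexx) => //.
  - exact: sort_le_sorted.
  - by rewrite inE size_s (leq_ltn_trans ij).
  - by rewrite inE size_s.
exists (nth 0 s); split=> //.
  rewrite -size_s -(big_nth 0 xpredT id) /=.
  rewrite (perm_big (map w (enum C))) ?perm_sort // big_map big_enum.
  by apply: eq_bigl => c.
move=> i iC.
have -> : #|[set c | w c <= nth 0 s i]| = count (<= nth 0 s i) s.
  rewrite count_sort count_map -sum1_count big_enum_cond -sum1_card.
  by apply: eq_bigl => c; rewrite !inE.
pose p : pred rat := (<= nth 0 s i); rewrite -/p.
apply: (@leq_trans (count p (take i.+1 s))); last first.
  by rewrite -{2}(cat_take_drop i.+1 s) count_cat leq_addr.
suff /eqP -> : count p (take i.+1 s) == i.+1 by [].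
have st : size (take i.+1 s) = i.+1 by rewrite size_takel // size_s.
rewrite -{2}st -all_count; apply/(all_nthP 0) => k.
rewrite st ltnS => ki; rewrite nth_take ?ltnS // /p /=; exact: mono.
Qed.

Lemma sum_blocks (u : nat -> rat) (r m : nat) :
  \sum_(0 <= i < r * m) u i = \sum_(k < r) \sum_(a < m) u (k * m + a)%N.
Proof.
rewrite big_nat_mul big_mkord; apply: eq_bigr => k _.
by rewrite -{1}[(k * m)%N]add0n mulSn big_addn addnK big_mkord;
   apply: eq_bigr => a _; rewrite addnC.
Qed.

Lemma count_ord_lt (m p : nat) : (p <= m)%N ->
  \sum_(a < m) ((a < p)%N%:R : rat) = p%:R.
Proof.
move=> pm; rewrite -natr_sum; congr (_%:R).
rewrite -(subnKC pm) big_split_ord /=.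
rewrite (eq_bigr (fun=> 1%N)); last by move=> i _; rewrite /= ltn_ord.
rewrite [X in (_ + X)%N]big1 ?sum_nat_const ?card_ord ?muln1 ?addn0 //.
by move=> i _; rewrite /= ltnNge leq_addr.
Qed.

(* Makes the gain at the jump J j in the proof below outweigh the loss
   r^2 e max_k J k, where J k <= (4r^2)^r J j and the gain per vertex is J j / (4r). *)
Definition slack (r e : nat) : nat := (4 * r ^ 3 * (4 * r ^ 2) ^ r * e)%N.

(** Greedy embedding places label [k] at weight at most [ck k], the weight at index [k * (m + e)],
    while block [k] of the sorted weights starts at index [k * m]. This shift is the loss. Either
    the weights shortly before index [j * m] are high enough to pay for it, or [copy_in_large_set]
    gives a copy so much lighter at label [j] that [sumc] must be large. *)
Lemma nonneg_weight_or_independent (C : finType) (E : rel C) (T : rel nat)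
    (r m e : nat) (w : C -> rat) :
  (1 < r)%N -> #|C| = (r * m)%N -> tournament_on T r ->
  (forall c, #|nonout E c| <= m + e)%N -> (forall c, #|nonin E c| <= m + e)%N ->
  (slack r e + r * e < m)%N ->
  (forall g : nat -> C, partial_copy E T g r -> 0 <= \sum_(i < r) w (g i)) ->
  0 <= \sum_c w c \/
  (exists I : {set C}, (forall a b, a \in I -> b \in I -> ~~ E a b) /\
     (m <= #|I| + (2 * r + 1) * (slack r e + r * e))%N).
Proof.
move=> r1 cardC Ttour Hout Hin dm wcopy.
have [u [u_mono -> u_card]] := sorted_weights w.
rewrite cardC in u_mono u_card *.
set d := slack r e in dm *.
pose ck k := u (k * (m + e))%N.
(* With [J 0 = 0], a dominant jump at index 0 means that there is no jump at all, and then nothing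
   is lost. *)
pose J k := if k is k'.+1 then ck k - ck k' else 0.
have ck_lt k : (k < r)%N -> (k * (m + e) < r * m)%N by nia.
have J0 k : (k < r)%N -> 0 <= J k.
  case: k => //= k kr; rewrite subr_ge0; apply: u_mono; last exact: ck_lt.
  by rewrite leq_mul2r leqnSn orbT.
(* With this [B], the climb over the jumps before [j], added up over [r] labels, costs at most
   [J j / 4], and [bonus] costs another [J j / 4]. The light copy saves [J j] at label [j], so half
   of it remains. *)
pose B : rat := 4%:R * r%:R ^+ 2.
have r_ge2 : (2 : rat) <= r%:R by rewrite (ler_nat _ 2).
have r0 : (0 : rat) < r%:R by lra.
have B1 : 1 <= B by rewrite /B; nra.
have B0 : 0 < B by lra.
have dE : d%:R = 4 * r%:R ^+ 3 * B ^+ r * e%:R.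
  by rewrite /d /slack !(natrM, natrX).
(* The weights B^-i make the jump at j dominate all earlier ones by a factor B and
   the later ones up to a constant. *)
have [j jmax] : exists j : 'I_r, forall i : 'I_r, J i / B ^+ i <= J j / B ^+ j.
  have i0 : 'I_r by exists 0%N; apply: ltn_trans r1.
  case: (@arg_maxP _ _ _ i0 xpredT (fun i : 'I_r => J i / B ^+ i)) => // j _ h.
  by exists j => i; apply: h.
have Jj0 := J0 j (ltn_ord j).
have JB k : (k < r)%N -> J k <= J j * B ^+ r.
  move=> kr; have := jmax (Ordinal kr); rewrite /= ler_pdivrMr ?exprn_gt0 //.
  move=> /le_trans; apply; rewrite -mulrA; apply: ler_wpM2l => //.
  rewrite mulrC ler_pdivrMr ?exprn_gt0 // -exprD.
  by apply: ler_weXn2l => //; lia.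
have JB' k : (k < j)%N -> J k <= J j / B.
  move=> kj; have kr : (k < r)%N by apply: ltn_trans (ltn_ord j).
  have := jmax (Ordinal kr); rewrite /= ler_pdivrMr ?exprn_gt0 //.
  move=> /le_trans; apply; rewrite -mulrA; apply: ler_wpM2l => //.
  rewrite mulrC ler_pdivrMr ?exprn_gt0 // ler_pdivlMl // -exprS.
  exact: ler_weXn2l.
pose sumc := \sum_(k < r) ck k.
have sumc0 : 0 <= sumc.
  have /card_gt0P[c0 _] : (0 < #|C|)%N by rewrite cardC; nia.
  pose A i := [set c | w c <= ck i].
  have [|||i /andP[_ ir]|g [gcopy _ gA]] := @greedy_copy C E T r (m + e) A
      (fun=> c0) 0 r Ttour Hout Hin => //.
    exact: u_card (ck_lt _ ir).
  apply: le_trans (wcopy g gcopy) _; apply: ler_sum => i _.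
  by have := gA i (ltn_ord i); rewrite inE.
(* In block [k] only the first [k * e] positions precede index [k * (m + e)], and they lie at most
   [J k] below [ck k]. The parameter [bonus] is a possible gain on the last [d] positions of block
   [j - 1]. *)
have sum_lower (bonus : rat) :
    (forall (k a : nat), (k < r)%N -> (a < m)%N ->
       ck k - (a < k * e)%N%:R * J k +
         ((k.+1 == j) && (m - d <= a))%N%:R * bonus <= u (k * m + a)%N) ->
    m%:R * sumc - r%:R ^+ 2 * e%:R * (J j * B ^+ r) +
      (0 < j)%N%:R * (d%:R * bonus) <= \sum_(0 <= i < r * m) u i.
  move=> low; rewrite sum_blocks.
  have blk (k : 'I_r) : m%:R * ck k - (k * e)%:R * J k +
      (k.+1 == j)%N%:R * (d%:R * bonus) <= \sum_(a < m) u (k * m + a)%N.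
    apply: le_trans (ler_sum _ (fun (a : 'I_m) _ => low k a (ltn_ord k) (ltn_ord a))).
    rewrite big_split sumrB /= -mulr_suml count_ord_lt; last first.
      by have := ltn_ord k; nia.
    rewrite sumr_const card_ord -[ck k *+ _]mulr_natl lerD2l -mulr_suml mulrA.
    suff -> : \sum_(a < m) ((k.+1 == j) && (m - d <= a))%N%:R =
        (k.+1 == j)%N%:R * d%:R :> rat by [].
    case: (k.+1 == j) => /=; last by rewrite big1 ?mul0r.
    have -> : d%:R = m%:R - (m - d)%N%:R :> rat by rewrite natrB; [ring|lia].
    rewrite -(@count_ord_lt m (m - d)); last by lia.
    rewrite -[X in X%:R - _](card_ord m) -sumr_const -sumrB mul1r.
    by apply: eq_bigr => a _; case: ltnP => _; rewrite ?subr0 ?subrr.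
  apply: le_trans (ler_sum _ (fun k _ => blk k)).
  rewrite big_split sumrB /= -mulr_sumr -/sumc.
  have -> : \sum_(k < r) ((k.+1 == j)%N%:R * (d%:R * bonus)) =
      (0 < j)%N%:R * (d%:R * bonus).
    rewrite -mulr_suml; congr (_ * _); case: (posnP j) => [->|j0].
      by rewrite big1.
    have jr : (j.-1 < r)%N by have := ltn_ord j; lia.
    rewrite (bigD1 (Ordinal jr)) //= prednK // eqxx big1 ?addr0 // => k kj.
    by case: eqP => // kE; case/eqP: kj; apply: val_inj; rewrite /= -kE.
  rewrite lerD2r lerD2l lerN2.
  apply: (@le_trans _ _ (\sum_(k < r) r%:R * e%:R * (J j * B ^+ r))).
    apply: ler_sum => k _; rewrite natrM.
    apply: ler_pM; rewrite ?mulr_ge0 ?ler0n ?J0 ?JB //.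
    by apply: ler_wpM2r; rewrite ?ler0n // ler_nat ltnW.
  by rewrite sumr_const card_ord -[X in X <= _]mulr_natl !mulrA -expr2.
have u_step k a : (k < r)%N -> (a < m)%N ->
    ck k - (a < k * e)%N%:R * J k <= u (k * m + a)%N.
  move=> kr am; case: ltnP => ake.
    case: k kr ake => [|k] kr ake; first by lia.
    by rewrite mul1r /= opprB addrC subrK; apply: u_mono; nia.
  by rewrite mul0r subr0; apply: u_mono; nia.
have e_small : r%:R ^+ 2 * e%:R * (J j * B ^+ r) * (4 * r%:R) = d%:R * J j.
  rewrite dE; ring.
have Jzero : J j = 0 -> 0 <= \sum_(0 <= i < r * m) u i.
  move=> Jj; apply: le_trans (sum_lower 0 _).
    by rewrite Jj mul0r !mulr0 subr0 addr0 mulr_ge0.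
  by move=> k a kr am; rewrite mulr0 addr0; apply: u_step.
have [/Jzero|Jj_neq0] := eqVneq (J j) 0; first by left.
have Jj_gt0 : 0 < J j by rewrite lt_def Jj_neq0.
have j_gt0 : (0 < j)%N by case: (j : nat) Jj_neq0 => //; rewrite eqxx.
pose bonus := J j / (4 * r%:R).
have bonusE : bonus * (4 * r%:R) = J j.
  by rewrite /bonus mulfVK //; apply: lt0r_neq0; lra.
pose thr := ck j.-1 + bonus.
have jr := ltn_ord j.
have jm_lt : (j * m - d < r * m)%N by clear -dm jr; nia.
(* High weights from index [j * m - d] on give the bonus; otherwise more than [j * m - d] vertices
   are lighter than [thr], enough for [copy_in_large_set]. *)
have [thr_le|thr_gt] := lerP thr (u (j * m - d)%N).
  left; apply: le_trans (sum_lower bonus _).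
    rewrite j_gt0 mul1r; apply: (@le_trans _ _ (m%:R * sumc)).
      by rewrite mulr_ge0.
    rewrite -addrA lerDl addrC subr_ge0.
    rewrite -(@ler_pM2r _ (4 * r%:R)) ?e_small; last by lra.
    by rewrite -mulrA bonusE.
  move=> k a kr am.
  have [/andP[/eqP kj ma]|_] := boolP ((k.+1 == j) && _); last first.
    by rewrite mul0r addr0; apply: u_step.
  rewrite ltnNge (_ : (k * e <= a)%N) /=; last first.
    by clear -dm ma kr; nia.
  rewrite mul0r subr0 mul1r.
  move: thr_le; rewrite /thr -kj /= => /le_trans; apply.
  by apply: u_mono; clear -dm ma kr am kj; nia.
have [] := @copy_in_large_set C E T r m e d j [set c | w c < thr] Ttour Hout Hin
    j_gt0 (ltn_ord j) dm.
- have : (j * m - d < #|[set c | (w c <= u (j * m - d)%N)%R]|)%N by apply: u_card.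
  have : (#|[set c | (w c <= u (j * m - d)%N)%R]| <= #|[set c | (w c < thr)%R]|)%N.
    apply: subset_leq_card; apply/subsetP => c; rewrite !inE => wc.
    exact: le_lt_trans thr_gt.
  clear; lia.
- move=> [g [gcopy gS]]; left.
  pose A i := [set c | w c <= ck i].
  have [//|i /andP[_ ir]|g' [g'copy g'g g'A]] := @greedy_copy C E T r (m + e) A
      g j.+1 r Ttour Hout Hin (ltn_ord j) _ gcopy.
    exact: u_card (ck_lt _ ir).
  have ckj1 i : (i <= j.-1)%N -> ck j.-1 <= ck i + r%:R * (J j / B).
    have : forall t i, (i + t = j.-1)%N -> ck j.-1 <= ck i + t%:R * (J j / B).
      elim=> [|t IHt] i' it; first by rewrite -it addn0 mul0r addr0.
      have i'j : (i'.+1 < j)%N by clear -it j_gt0; lia.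
      apply: (le_trans (IHt i'.+1 _)); first by clear -it; lia.
      have := JB' _ i'j; rewrite /= -natr1 mulrDl mul1r; clear; lra.
    move=> /(_ (j.-1 - i)%N i) + ij; rewrite subnKC // => /(_ erefl).
    move=> /le_trans; apply; rewrite lerD2l; apply: ler_wpM2r.
      by rewrite divr_ge0 // ltW.
    by rewrite ler_nat; clear -jr; lia.
  pose v := r%:R * (J j / B).
  have v0 : 0 <= v by rewrite mulr_ge0 // divr_ge0 // ltW.
  have rv : r%:R * v = J j / 4.
    by rewrite /v /B; field; rewrite gt_eqF.
  have wi (i : 'I_r) : w (g' i) <= ck i + (bonus + v) - (i == j)%:R * J j.
    have [ij|ij|ij] := ltngtP i j.
    - rewrite -val_eqE /= (ltn_eqF ij) mul0r subr0.
      have := gS i (ltnW ij); rewrite inE (g'g i (ltnW ij)) => /ltW.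
      have ij1 : (i <= j.-1)%N by clear -ij; lia.
      have := ckj1 i ij1; rewrite /thr -/v; clear; lra.
    - rewrite -val_eqE /= (gtn_eqF ij) mul0r subr0.
      have := g'A i; rewrite ij ltn_ord => /(_ isT); rewrite inE.
      rewrite /bonus; have := divr_ge0 Jj0 (_ : 0 <= 4 * r%:R); lra.
    - have -> : i = j by apply: val_inj.
      have := gS j (leqnn j); rewrite inE (g'g j (leqnn j)) eqxx mul1r => /ltW.
      rewrite /thr /J; case: (j : nat) j_gt0 => //= k _; lra.
  have sum_copy : 0 <= sumc + r%:R * (bonus + v) - J j.
    apply: (le_trans (wcopy g' g'copy)); apply: (le_trans (ler_sum _ (fun i _ => wi i))).
    rewrite sumrB big_split /= -/sumc sumr_const card_ord.
    rewrite -[(bonus + v) *+ _]mulr_natl -mulr_suml.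
    rewrite (bigD1 j) //= eqxx big1 ?addr0 ?mul1r //.
    by move=> i /negbTE->.
  have sumcJ : J j / 2 <= sumc by lra.
  apply: le_trans (sum_lower 0 _); last first.
    by move=> k a kr am; rewrite mulr0 addr0; apply: u_step.
  rewrite !mulr0 addr0 subr_ge0 -(@ler_pM2r _ (4 * r%:R)) ?e_small; last by lra.
  have dm' : d%:R <= m%:R :> rat by rewrite ler_nat; clear -dm; lia.
  have h1 : m%:R * (J j / 2) * (4 * r%:R) <= m%:R * sumc * (4 * r%:R).
    by rewrite ler_wpM2r ?ler_wpM2l ?mulr_ge0 //; lra.
  apply: le_trans h1.
  rewrite (_ : m%:R * (J j / 2) * (4 * r%:R) = m%:R * J j * (2 * r%:R)); last by field.
  have : d%:R * J j <= m%:R * J j by rewrite ler_wpM2r.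
  have : 0 <= m%:R * J j by rewrite mulr_ge0.
  nra.
- move=> [I [Iind Icard]]; right; exists I; split=> //.
Qed.

(** The weights are [y f / D] with the denominator cleared. Maps may repeat vertices at this stage,
    so vertices count with multiplicity. *)
Definition fractional_tiling (r : nat) (C : finType) (E : rel C) (T : rel nat)
    (D : nat) (y : {ffun 'I_r -> C} -> nat) : Prop :=
  (forall f, (0 < y f)%N -> forall i j : 'I_r, T i j -> E (f i) (f j)) /\
  forall c, (\sum_f y f * #|[set i | f i == c]|)%N = D.

(** Farkas' lemma for the all-ones vector and the multiplicity vectors of the copies; its dual
    solution is a weight function excluded by [nonneg_weight_or_independent]. Rational coefficients
    make a common denominator available. *)
Lemma fractional_tiling_or_independent (C : finType) (E : rel C) (T : rel nat)
    (r m e : nat) :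
  (1 < r)%N -> #|C| = (r * m)%N -> tournament_on T r ->
  (forall c, #|nonout E c| <= m + e)%N -> (forall c, #|nonin E c| <= m + e)%N ->
  (slack r e + r * e < m)%N ->
  (exists D (y : {ffun 'I_r -> C} -> nat),
     (0 < D)%N /\ fractional_tiling E T D y) \/
  (exists I : {set C}, (forall a b, a \in I -> b \in I -> ~~ E a b) /\
     (m <= #|I| + (2 * r + 1) * (slack r e + r * e))%N).
Proof.
move=> r1 cardC Ttour Hout Hin dm.
have /card_gt0P[c0 _] : (0 < #|C|)%N by rewrite cardC; nia.
pose copy (f : {ffun 'I_r -> C}) :=
  [forall i : 'I_r, forall j : 'I_r, T i j ==> E (f i) (f j)].
pose mult (f : {ffun 'I_r -> C}) c := #|[set i | f i == c]|.
pose s := enum [pred f | copy f].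
pose f0 : {ffun 'I_r -> C} := [ffun=> c0].
have s_copy i : (i < size s)%N -> copy (nth f0 s i).
  by move=> /(mem_nth f0); rewrite mem_enum.
have mult_sum f (w : C -> rat) :
    \sum_c (mult f c)%:R * w c = \sum_(i < r) w (f i).
  rewrite (partition_big f xpredT) //=; apply: eq_bigr => c _.
  rewrite (eq_bigr (fun=> w c)); last by move=> i /eqP->.
  by rewrite big_const iter_addr addr0 mulr_natl /mult cardsE.
have [[x [x0 xE]]|[w [w0 wneg]]] := farkas (size s)
    (fun i c => (mult (nth f0 s i) c)%:R : rat) (fun=> 1).
- left.
  pose X (f : {ffun 'I_r -> C}) := if copy f then x (index f s) else 0.
  have X0 f : 0 <= X f by rewrite /X; case: ifP.
  have [D [y [D0 yE]]] := clear_denominators X0.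
  exists D, y; split=> //; split.
    move=> f yf i j Tij; have : copy f.
      apply: contraLR yf => ncf; rewrite lt0n negbK.
      by have := yE f; rewrite /X (negbTE ncf) mulr0 => /eqP; rewrite pnatr_eq0.
    by move=> /forallP/(_ i)/forallP/(_ j)/implyP; apply.
  move=> c; apply/eqP; rewrite -(eqr_nat rat) natr_sum.
  under eq_bigr => f _ do rewrite natrM yE -mulrA.
  rewrite -mulr_sumr -[X in _ == X]mulr1; apply/eqP; congr (_ * _).
  rewrite [RHS](xE c) (bigID copy) /= [X in _ + X]big1 ?addr0; last first.
    by move=> f ncf; rewrite /X (negbTE ncf) mul0r.
  rewrite -big_enum -/s (big_nth f0) big_mkord; apply: eq_bigr => i _.
  by rewrite /X s_copy // index_uniq ?enum_uniq.
- case: (@nonneg_weight_or_independent C E T r m e w) => //; last by right.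
  + move=> g gcopy; pose f : {ffun 'I_r -> C} := [ffun i : 'I_r => g i].
    have cf : copy f.
      apply/forallP => i; apply/forallP => j; apply/implyP => Tij.
      by rewrite !ffunE; apply: gcopy.
    have fs : f \in s by rewrite mem_enum.
    have := w0 (index f s); rewrite index_mem fs nth_index // => /(_ isT).
    by rewrite mult_sum; under eq_bigr => i _ do rewrite ffunE.
  + move=> sum0; move: wneg; under eq_bigr => c _ do rewrite mul1r.
    by rewrite ltNge sum0.
Qed.

Lemma fractional_tilingM (r : nat) (C : finType) (E : rel C) (T : rel nat)
    (D k : nat) (y : {ffun 'I_r -> C} -> nat) :
  fractional_tiling E T D y ->
  fractional_tiling E T (k * D) (fun f => k * y f)%N.
Proof.
move=> [ycopy ysum]; split.
  by move=> f; rewrite muln_gt0 => /andP[_]; apply: ycopy.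
by move=> c; rewrite -(ysum c) big_distrr /=; apply: eq_bigr => f _; rewrite mulnA.
Qed.

Definition nat_rel (r : nat) (T : rel 'I_r) : rel nat := fun i j =>
  if insub i is Some i' then if insub j is Some j' then T i' j' else false
  else false.

(** For fixed [C] and [r] there are finitely many pairs [(E, T)], and the product of their
    denominators serves them all. The size [D] of the blow-up must be known before the box theorem
    decides which host appears. *)
Lemma uniform_denominator (r : nat) (C : finType) :
  exists D, (0 < D)%N /\ forall (E : rel C) (T : rel 'I_r),
    (exists D' (y : {ffun 'I_r -> C} -> nat),
       (0 < D')%N /\ fractional_tiling E (nat_rel T) D' y) ->
    exists y : {ffun 'I_r -> C} -> nat, fractional_tiling E (nat_rel T) D y.
Proof.
pose cur (X : finType) (F : {ffun X * X -> bool}) : rel X := fun a b => F (a, b).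
pose code := ({ffun C * C -> bool} * {ffun 'I_r * 'I_r -> bool})%type.
pose tiling (ET : code) D (y : {ffun 'I_r -> C} -> nat) :=
  fractional_tiling (cur _ ET.1) (nat_rel (cur _ ET.2)) D y.
pose good ET D := (0 < D)%N /\
  ((exists D' y, (0 < D')%N /\ tiling ET D' y) -> exists y, tiling ET D y).
have [D DP] : exists D : code -> nat, forall ET, good ET (D ET).
  apply: (@fin_all_exists _ (fun=> nat) good) => ET.
  have [[D [y [D0 Dy]]]|no] := EM (exists D' y, (0 < D')%N /\ tiling ET D' y).
    by exists D; split=> // _; exists y.
  by exists 1%N; split.
exists (\prod_ET D ET)%N; split.
  by rewrite prodn_gt0 // => ET; have [] := DP ET.
move=> E T.
pose ET : code := ([ffun p => E p.1 p.2], [ffun p => T p.1 p.2]).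
have -> : E = cur _ ET.1 by apply/funext => a; apply/funext => b; rewrite /cur ffunE.
have -> : T = cur _ ET.2 by apply/funext => a; apply/funext => b; rewrite /cur ffunE.
move=> h; have [_ /(_ h)[y yD]] := DP ET.
exists (fun f => (\prod_(ET' | ET' != ET) D ET') * y f)%N.
rewrite (bigD1 ET) //= mulnC; exact: fractional_tilingM.
Qed.

(** * Blow-ups in dense hypergraphs *)

Local Open Scope nat_scope.

Lemma subset_of_card (X : finType) (A : {set X}) (k : nat) :
  k <= #|A| -> exists2 A' : {set X}, A' \subset A & #|A'| = k.
Proof.
move=> kA; exists [set x in take k (enum A)].
  by apply/subsetP => x; rewrite inE => /mem_take; rewrite mem_enum.
rewrite cardsE; have /card_uniqP -> : uniq (take k (enum A)).
  by rewrite take_uniq // enum_uniq.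
by rewrite size_takel // -cardE.
Qed.

(** By averaging, at least a fraction [1 / (2 * q)] of the [z] see [D] or more elements of [W], and
    some [D]-subset receives its share of them. The subsets are counted crudely by [2 ^ #|W|], so
    [W] should have bounded size. *)
Lemma common_subset (X Z : finType) (W : {set X}) (P : X -> Z -> bool)
    (q D : nat) :
  0 < q -> #|W| >= 2 * q * D -> 0 < D ->
  #|W| * #|Z| <= q * \sum_(x in W) #|[set z | P x z]| ->
  exists W' : {set X}, [/\ W' \subset W, #|W'| = D &
    #|Z| <= 2 * q * 2 ^ #|W| * #|[set z | [forall x in W', P x z]]|].
Proof.
move=> q0 WD D0 sumP.
pose Wz z := [set x in W | P x z].
pose Z1 := [set z | D <= #|Wz z|].
have sumE : \sum_(x in W) #|[set z | P x z]| = \sum_z #|Wz z|.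
  under eq_bigr => x _ do rewrite -sum1_card.
  under [RHS]eq_bigr => z _ do rewrite -sum1_card.
  rewrite (exchange_big_dep xpredT) //=; apply: eq_bigr => z _.
  by apply: eq_bigl => x; rewrite !inE.
have sum_le : \sum_z #|Wz z| <= #|W| * #|Z1| + D * #|Z|.
  rewrite (bigID (mem Z1)) /=; apply: leq_add.
    rewrite mulnC -sum_nat_const; apply: leq_sum => z _.
    by apply: subset_leq_card; apply/subsetP => x; rewrite inE => /andP[].
  rewrite mulnC -sum_nat_const [X in _ <= X](bigID (mem Z1)) /=.
  apply: leq_trans (leq_addl _ _).
  by apply: leq_sum => z; rewrite inE -ltnNge => /ltnW.
have Z1_large : #|Z| <= 2 * q * #|Z1|.
  rewrite sumE in sumP.
  have h : #|W| * #|Z| <= q * (#|W| * #|Z1|) + q * (D * #|Z|).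
    by rewrite -mulnDr (leq_trans sumP) // leq_mul2l sum_le orbT.
  have h2 : 2 * q * D * #|Z| <= #|W| * #|Z| by rewrite leq_mul2r WD orbT.
  have W0 : 0 < #|W| by apply: leq_trans WD; rewrite !muln_gt0 q0 D0.
  rewrite -(leq_pmul2l W0); nia.
pose F (W' : {set X}) := [set z | [forall x in W', P x z]].
pose sub := [pred W' : {set X} | (W' \subset W) && (#|W'| == D)].
have [/exists_inP[W' /andP[W'W /eqP W'D] W'F]|] :=
    boolP [exists W' in sub, #|Z1| <= 2 ^ #|W| * #|F W'|].
  exists W'; split=> //; apply: leq_trans Z1_large _.
  by rewrite -[X in _ <= X]mulnA leq_mul2l W'F orbT.
rewrite negb_exists_in => /forall_inP small; exfalso.
have Z1F : #|Z1| <= \sum_(W' in sub) #|F W'|.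
  apply: leq_trans (card_bigcup_le _ _); apply: subset_leq_card.
  apply/subsetP => z; rewrite inE => Dz; apply/bigcupP.
  have [W' W'z W'D] : exists2 W' : {set X}, W' \subset Wz z & #|W'| = D.
    exact: subset_of_card.
  exists W'.
    rewrite inE W'D eqxx andbT; apply: (subset_trans W'z).
    by apply/subsetP => x; rewrite inE => /andP[].
  rewrite inE; apply/forall_inP => x /(subsetP W'z).
  by rewrite inE => /andP[].
have sub_card : #|sub| <= 2 ^ #|W|.
  rewrite -card_powerset; apply: subset_leq_card; apply/subsetP => W'.
  by rewrite !inE => /andP[].
have [sub0|[W0 W0s]] := set_0Vmem [set W' in sub].
  have sub0' : #|sub| = 0 by rewrite -cardsE sub0 cards0.
  have Z1_0 : #|Z1| = 0.
    apply/eqP; rewrite -leqn0 (leq_trans Z1F) // big_pred0 // => W'.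
    by apply/negbTE; move/card0_eq: sub0' => ->.
  have Z0 : #|Z| = 0 by apply/eqP; rewrite -leqn0 (leq_trans Z1_large) // Z1_0 muln0.
  have [W' W'W W'D] : exists2 W' : {set X}, W' \subset W & #|W'| = D.
    by apply: subset_of_card; apply: leq_trans WD; nia.
  have : W' \in sub by rewrite inE W'W W'D eqxx.
  by move/card0_eq: sub0' => ->.
rewrite inE in W0s.
have [Wm Wms Wmax] : exists2 Wm, Wm \in sub &
    forall W', W' \in sub -> #|F W'| <= #|F Wm|.
  by case: (arg_maxnP (fun W' => #|F W'|) W0s) => Wm Wms Wmax; exists Wm.
have := small Wm Wms; rewrite -ltnNge ltnNge => /negP; apply.
apply: leq_trans Z1F _; apply: (@leq_trans (#|sub| * #|F Wm|)).
  by rewrite -sum_nat_const; apply: leq_sum => W'; apply: Wmax.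
by rewrite leq_mul2r sub_card orbT.
Qed.

Definition ffun_cons (B : Type) (s : nat) (b : B) (t : {ffun 'I_s -> B}) :
    {ffun 'I_s.+1 -> B} :=
  [ffun i => if unlift ord0 i is Some j then t j else b].

Lemma ffun_cons_card (B : finType) (s : nat) (A : {set {ffun 'I_s.+1 -> B}}) :
  #|A| = \sum_(b : B) #|[set t : {ffun 'I_s -> B} | ffun_cons b t \in A]|.
Proof.
rewrite -sum1_card (partition_big (fun t : {ffun 'I_s.+1 -> B} => t ord0) xpredT) //=.
apply: eq_bigr => b _; rewrite -sum1_card.
rewrite (reindex_onto (ffun_cons b) (fun t => [ffun j => t (lift ord0 j)])) /=.
  apply: eq_bigl => t; rewrite inE ffunE unlift_none eqxx andbT.
  rewrite (_ : _ == t) ?andbT //; apply/eqP/ffunP => j.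
  by rewrite !ffunE liftK.
move=> t /andP[_ /eqP tb]; apply/ffunP => i; rewrite ffunE.
by case: unliftP => [j ->|->]; rewrite ?ffunE.
Qed.

(* Erdos' box theorem for s-partite s-graphs with all parts equal to B. *)
Lemma box_in_dense (s q D : nat) :
  0 < q -> 0 < D -> exists N, forall (B : finType) (A : {set {ffun 'I_s -> B}}),
    N <= #|B| -> #|B| ^ s <= q * #|A| ->
    exists W : 'I_s -> {set B}, (forall i, #|W i| = D) /\
      forall t : {ffun 'I_s -> B}, (forall i, t i \in W i) -> t \in A.
Proof.
move=> q0 D0; elim: s q q0 => [|s IHs] q q0.
  exists 0 => B A _; rewrite expn0 => qA.
  have [t tA] : exists t, t \in A by apply/set0Pn; rewrite -card_gt0; nia.
  exists (fun=> set0); split; first by case.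
  by move=> t' _; rewrite (_ : t' = t) //; apply/ffunP => -[].
(* The [heavy] elements have density at least [1 / (2 * q)], so [common_subset] runs with [2 * q]
   and asks for [2 * (2 * q) * D] of them. Keeping exactly [w] makes the lost factor [2 ^ w]
   independent of [B]. *)
pose w := 4 * q * D.
have [|N NP] := IHs (2 * (2 * q) * 2 ^ w).
  by rewrite !muln_gt0 q0 expn_gt0.
exists (N + 2 * q * w + 1) => B A NB; rewrite ffun_cons_card => qA.
pose deg b := #|[set t : {ffun 'I_s -> B} | ffun_cons b t \in A]|.
pose heavy := [set b | #|B| ^ s <= 2 * q * deg b].
have deg_le b : deg b <= #|B| ^ s.
  by rewrite -[X in _ <= _ ^ X]card_ord -card_ffun max_card.
have sum_le : 2 * q * \sum_b deg b <= 2 * q * (#|heavy| * #|B| ^ s) + #|B| * #|B| ^ s.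
  rewrite (bigID (mem heavy)) /= mulnDr; apply: leq_add.
    rewrite leq_mul2l -sum_nat_const leq_sum ?orbT //.
  rewrite big_distrr -sum_nat_const [X in _ <= X](bigID (mem heavy)) /=.
  apply: leq_trans (leq_addl _ _); apply: leq_sum => b.
  by rewrite inE -ltnNge => /ltnW.
have B0 : 0 < #|B| by lia.
have Bs0 : 0 < #|B| ^ s by rewrite expn_gt0 B0.
have heavy_large : w <= #|heavy|.
  have : #|B| * #|B| ^ s <= 2 * q * #|heavy| * #|B| ^ s.
    have qA' : #|B| * #|B| ^ s <= q * \sum_b deg b by rewrite -expnS.
    clear -qA' sum_le; nia.
  rewrite leq_pmul2r // => h; rewrite -(@leq_pmul2l (2 * q)); last by lia.
  by apply: leq_trans h; lia.
have [W Wheavy Ww] := subset_of_card heavy_large.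
have [||//||W' [W'W W'D W'Z]] := @common_subset B {ffun 'I_s -> B} W
    (fun b t => ffun_cons b t \in A) (2 * q) D.
- by rewrite muln_gt0.
- by rewrite Ww /w; lia.
- rewrite card_ffun card_ord big_distrr -sum_nat_const /=.
  by apply: leq_sum => b /(subsetP Wheavy); rewrite inE.
rewrite Ww card_ffun card_ord in W'Z.
have [|V [VD VA]] := NP B _ _ W'Z; first by lia.
exists (fun i => if unlift ord0 i is Some j then V j else W'); split.
  by move=> i; case: unlift.
move=> t tV; pose t' := [ffun j => t (lift ord0 j)].
have -> : t = ffun_cons (t ord0) t'.
  by apply/ffunP => i; rewrite !ffunE; case: unliftP => [j ->|->]; rewrite ?ffunE.
have : t' \in [set z | [forall x in W', ffun_cons x z \in A]].
  by apply: VA => j; have := tV (lift ord0 j); rewrite liftK /t' ffunE.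
rewrite inE => /forall_inP; apply.
by have := tV ord0; rewrite unlift_none.
Qed.

Local Open Scope ring_scope.

(** * Concentration for sampled blocks *)

(** Inverting [1 - y <= expR (- y)] suffices, since the quadratic times [1 - y] equals
    [1 + y ^+ 2 * (1 - 2 * y)]. *)
Lemma expR_le_quadratic (R : realType) (y : R) :
  y <= 1 / 2 -> expR y <= 1 + y + 2 * y ^+ 2.
Proof.
move=> y2; have h1 : 1 - y <= expR (- y) by have := expR_ge1Dx (- y).
have h2 : expR y * (1 - y) <= 1.
  rewrite -[X in _ <= X]expR0 -(subrr y) expRD.
  by apply: ler_wpM2l => //; exact: expR_ge0.
have h3 : 0 < 1 - y by lra.
rewrite -(ler_pM2r h3) (le_trans h2) //; nra.
Qed.

(** The deviation depends on two of the sampled coordinates themselves. Fixing [t i = b] and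
    [t i' = b'] leaves the others independent with mean at most 0, and the exponential moment method
    applies; the two fixed coordinates account for [2 * rho]. *)
Lemma chernoff_pair (R : realType) (B : finType) (s : nat) (i i' : 'I_s)
    (d : B -> B -> B -> R) (rho tau delta : R) :
  i != i' -> (forall b b', \sum_x d b b' x <= 0) ->
  (forall b b' x, `|d b b' x| <= rho) -> 0 < tau -> tau * rho <= 1 / 2 ->
  #|[set t : {ffun 'I_s -> B} | delta <= \sum_k d (t i) (t i') (t k)]|%:R *
    expR (tau * (delta - 2 * rho)) <=
  (#|B| ^ s)%:R * expR (2 * tau ^+ 2 * rho ^+ 2) ^+ s.
Proof.
move=> ii' d0 drho tau0 tau_rho.
set q := expR (2 * tau ^+ 2 * rho ^+ 2).
have q1 : 1 <= q.
  rewrite -[X in X <= _]expR0 ler_expR.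
  by rewrite mulr_ge0 ?sqr_ge0 // mulr_ge0 ?sqr_ge0.
(* The two fixed coordinates enter as 0-1 factors, so that the sum over all [t] splits into a
   product over coordinates. *)
pose G b b' k x : R :=
  if k == i then (x == b)%:R else if k == i' then (x == b')%:R
  else expR (tau * d b b' x).
have G0 b b' k x : 0 <= G b b' k x.
  by rewrite /G; case: ifP => _ //; case: ifP => _ //; exact: expR_ge0.
have sumG b b' : \sum_(t : {ffun 'I_s -> B}) \prod_k G b b' k (t k) <=
    (#|B| ^ (s - 2))%:R * q ^+ s.
  rewrite -(bigA_distr_bigA (G b b')) /=.
  rewrite (bigD1 i) //= (bigD1 i') 1?eq_sym //= {1 2}/G !eqxx (eq_sym i' i) (negbTE ii').
  have one (y : B) : \sum_x (x == y)%:R = 1 :> R.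
    rewrite (bigD1 y) //= eqxx big1 ?addr0 // => x /negbTE->.
    by [].
  rewrite !one !mul1r.
  apply: (@le_trans _ _ (\prod_(k | (k != i) && (k != i')) (#|B|%:R * q))).
    apply: ler_prod => k /andP[ki ki']; rewrite sumr_ge0 //=.
    rewrite /G (negbTE ki) (negbTE ki').
    apply: (@le_trans _ _ (\sum_x (1 + tau * d b b' x + 2 * (tau * rho) ^+ 2))).
      apply: ler_sum => x _.
      have dx := drho b b' x.
      have : tau * d b b' x <= tau * rho.
        by rewrite ler_pM2l //; apply: le_trans dx; exact: ler_norm.
      move=> le1; apply: (le_trans (expR_le_quadratic (le_trans le1 tau_rho))).
      rewrite lerD2l ler_wpM2l // -[X in X <= _]real_normK ?num_real //.
      rewrite ler_sqr ?nnegrE ?normr_ge0 //; last first.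
        by rewrite mulr_ge0 ?(ltW tau0) // (le_trans _ dx).
      by rewrite normrM (gtr0_norm tau0) ler_pM2l.
    rewrite !big_split /= -mulr_sumr !sumr_const -mulr_natl mulr1.
    rewrite -[(2 * _) *+ _]mulr_natl.
    apply: (@le_trans _ _ (#|B|%:R * (1 + 2 * tau ^+ 2 * rho ^+ 2))).
      have := d0 b b'; rewrite cardT -cardE; nra.
    by rewrite ler_wpM2l // /q; exact: expR_ge1Dx.
  rewrite prodr_const.
  have -> : #|[pred k | (k != i) && (k != i')]| = (s - 2)%N.
    have := cardC (pred2 i i'); rewrite card2 ii' (card_ord s) => cs.
    rewrite -[s in RHS]cs addKn.
    by apply: eq_card => k; rewrite !inE negb_or.
  rewrite exprMn natrX ler_wpM2l ?exprn_ge0 //.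
  by apply: ler_weXn2l => //; exact: leq_subr.
have s2 : (2 <= s)%N.
  by have := max_card (pred2 i i'); rewrite card2 ii' (card_ord s).
apply: (@le_trans _ _ (\sum_b \sum_b' \sum_(t : {ffun 'I_s -> B})
    \prod_k G b b' k (t k))); last first.
  apply: (@le_trans _ _ (\sum_(b : B) \sum_(b' : B) (#|B| ^ (s - 2))%:R * q ^+ s)).
    by apply: ler_sum => b _; apply: ler_sum => b' _.
  rewrite !sumr_const -!mulrnA -[X in X <= _]mulr_natl mulrA -natrM.
  by rewrite mulnn -expnD subnKC.
rewrite -sum1_card natr_sum mulr_suml.
under eq_bigr => t _ do rewrite mul1r.
rewrite (partition_big (fun t : {ffun 'I_s -> B} => t i) xpredT) //=.
apply: ler_sum => b _.
rewrite (partition_big (fun t : {ffun 'I_s -> B} => t i') xpredT) //=.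
apply: ler_sum => b' _.
rewrite [X in _ <= X](bigID (fun t : {ffun 'I_s -> B} =>
  [&& t \in [set t : {ffun 'I_s -> B} | delta <= \sum_k d (t i) (t i') (t k)],
      t i == b & t i' == b'])) /=.
rewrite -[X in X <= _]addr0; apply: lerD; last first.
  by apply: sumr_ge0 => t _; apply: prodr_ge0.
under eq_bigl => t do rewrite -andbA.
apply: ler_sum => t /and3P[]; rewrite inE => dt /eqP tb /eqP tb'.
rewrite (bigD1 i) //= (bigD1 i') 1?eq_sym //= {1 2}/G !eqxx (eq_sym i' i) (negbTE ii').
rewrite tb tb' !eqxx !mul1r.
rewrite (eq_bigr (fun k => expR (tau * d b b' (t k)))); last first.
  by move=> k /andP[/negbTE ki /negbTE ki']; rewrite /G ki ki'.
rewrite -expR_sum ler_expR -mulr_sumr ler_pM2l //.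
move: dt; rewrite tb tb' (bigD1 i) //= (bigD1 i') 1?eq_sym //= => dt.
have := drho b b' (t i); have := drho b b' (t i').
rewrite !ler_norml => /andP[_ h1] /andP[_ h2]; lra.
Qed.

Lemma sample_mean (R : realType) (r M : nat) (eps : R) :
  0 < eps -> eps <= 1 -> exists s0, forall s, (s0 <= s)%N ->
  forall (B : finType) (i i' : 'I_s) (h : B -> B -> B -> nat),
  (0 < #|B|)%N -> i != i' -> (forall b b' x, h b b' x <= r)%N ->
  (M * s ^ 2 * #|[set t : {ffun 'I_s -> B} |
     ((\sum_k h (t i) (t i') (t k))%N%:R <
      s%:R * ((\sum_x h (t i) (t i') x)%N%:R / #|B|%:R - eps))%R]| <= #|B| ^ s)%N.
Proof.
move=> eps0 eps1; pose rho : R := r.+1%:R.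
have rho1 : 1 <= rho by rewrite /rho (ler_nat _ 1).
(* The [tau] below maximizes [tau * eps - 2 * tau ^+ 2 * rho ^+ 2], and the maximum is [c]. The
   bound on [s] comes from [expR (s * c - 1) >= (s * c / 3) ^+ 3], which is to beat [M * s ^ 2]. *)
pose c : R := eps ^+ 2 / (8 * rho ^+ 2).
have c0 : 0 < c by rewrite divr_gt0 ?exprn_gt0 ?mulr_gt0 //; nra.
pose s0 := Num.bound `|27 * M%:R / c ^+ 3|.
have s0P : 27 * M%:R / c ^+ 3 <= s0%:R.
  apply: le_trans (ler_norm _) _; apply: ltW.
  by rewrite /s0; apply: archi_boundP; rewrite normr_ge0.
exists (maxn s0 1) => s; rewrite geq_max => /andP[s0s s1] B i i' h B0 ii' hr.
have s_large : 27 * M%:R / c ^+ 3 <= s%:R by rewrite (le_trans s0P) ?ler_nat.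
pose mean b b' : R := (\sum_x h b b' x)%N%:R / #|B|%:R.
have BR : 0 < #|B|%:R :> R by rewrite ltr0n.
have mean_bd b b' : 0 <= mean b b' <= r%:R.
  rewrite divr_ge0 //= ler_pdivrMr // -natrM ler_nat.
  by rewrite mulnC -sum_nat_const leq_sum.
pose tau := eps / (4 * rho ^+ 2).
have tau0 : 0 < tau by rewrite divr_gt0 //; nra.
have tauE : tau * rho ^+ 2 = eps / 4.
  by rewrite /tau; field; rewrite gt_eqF //; lra.
have tau_rho : tau * rho <= eps / 4 by rewrite -tauE ler_pM2l //; nra.
have := @chernoff_pair R B s i i' (fun b b' x => mean b b' - (h b b' x)%:R)
  rho tau (s%:R * eps) ii' _ _ tau0 _.
set bad := [set t : {ffun _} | _]; set bad' := [set t : {ffun _} | _].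
have bad_sub : bad' \subset bad.
  apply/subsetP => t; rewrite !inE sumrB sumr_const card_ord -mulr_natl natr_sum.
  rewrite /mean; lra.
move=> H; have {}H : #|bad|%:R * expR (tau * (s%:R * eps - 2 * rho)) <=
    (#|B| ^ s)%:R * expR (2 * tau ^+ 2 * rho ^+ 2) ^+ s.
  apply: H.
  - move=> b b'; rewrite sumrB sumr_const -natr_sum.
    by rewrite -[X in X - _]mulr_natr divfK ?gt_eqF // subrr.
  - move=> b b' x; have /andP[m0 m1] := mean_bd b b'.
    have h0 : 0 <= (h b b' x)%:R :> R by [].
    have h1 : (h b b' x)%:R <= r%:R :> R by rewrite ler_nat.
    rewrite ler_norml /rho -natr1; lra.
  - lra.
have exp_large : M%:R * s%:R ^+ 2 * expR (2 * tau ^+ 2 * rho ^+ 2) ^+ s <=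
    expR (tau * (s%:R * eps - 2 * rho)).
  rewrite -expRM_natl -ler_pdivlMr ?expR_gt0 // -expRN -expRD.
  have -> : tau * (s%:R * eps - 2 * rho) - s%:R * (2 * tau ^+ 2 * rho ^+ 2) =
      s%:R * c - 2 * (tau * rho).
    rewrite /c /tau; field; rewrite gt_eqF //; lra.
  apply: (@le_trans _ _ (expR (3%:R * ((s%:R * c - 1) / 3)))); last first.
    rewrite ler_expR mulrC divfK //; lra.
  rewrite expRM_natl.
  have h1 := expR_ge1Dx ((s%:R * c - 1) / 3).
  have sc0 : 0 < s%:R * c by rewrite mulr_gt0 ?ltr0n.
  have h2 : s%:R * c / 3 <= expR ((s%:R * c - 1) / 3) by lra.
  apply: (@le_trans _ _ ((s%:R * c / 3) ^+ 3)); last first.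
    by apply: lerXn2r; rewrite ?nnegrE ?expR_ge0 //; lra.
  move: s_large; rewrite ler_pdivrMr ?exprn_gt0 // => s_large.
  have -> : (s%:R * c / 3) ^+ 3 = s%:R * c ^+ 3 / 27 * s%:R ^+ 2 by field.
  by rewrite ler_wpM2r ?exprn_ge0 //; lra.
set E := expR (tau * _) in H exp_large; set Q := expR _ ^+ s in H exp_large.
have Q0 : 0 < Q by rewrite exprn_gt0 ?expR_gt0.
have bad_le : (#|bad'| <= #|bad|)%N by apply: subset_leq_card.
apply: (@leq_trans (M * s ^ 2 * #|bad|)); first by rewrite leq_mul2l bad_le orbT.
rewrite -(ler_nat R) natrM -(ler_pM2r Q0); apply: le_trans H.
rewrite natrM natrX mulrAC [X in _ <= X]mulrC ler_wpM2r //.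
Qed.

(* Row None holds r clones of the vertex x, row Some k the k-th sampled block. *)
Definition position (V B : finType) (r s : nat) (bl : B -> 'I_r -> V) (x : V)
    (t : {ffun 'I_s -> B}) (c : option 'I_s * 'I_r) : V :=
  if c.1 is Some k then bl (t k) c.2 else x.

Definition sample_count (V B : finType) (r s : nat) (bl : B -> 'I_r -> V) (x : V)
    (t : {ffun 'I_s -> B}) (X : {set V}) : nat :=
  #|[set c | position bl x t c \in X]|.

(** The sets whose share in the sample matters are defined by sampled vertices, hence the two
    arguments of [X]. Upper bounds on a share are obtained from the complement. *)
Definition sample_bad (R : realType) (V B : finType) (r s : nat)
    (bl : B -> 'I_r -> V) (eps : R) (x : V) (X : V -> V -> {set V})
    (t : {ffun 'I_s -> B}) : bool :=
  [exists c, exists c',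
     let Y := X (position bl x t c) (position bl x t c') in
     (sample_count bl x t Y)%:R < s%:R * (r%:R * #|Y|%:R / #|V|%:R - eps)].

(** Clones of [x], or two positions in one block, involve fewer than two coordinates; they are
    padded to two distinct ones, as [sample_mean] expects. *)
Lemma two_rows (s : nat) (k k' : option 'I_s) : (1 < s)%N ->
  exists i i', [/\ i != i', k \in [:: None; Some i; Some i']
    & k' \in [:: None; Some i; Some i']].
Proof.
move=> s1; have other (k0 : 'I_s) : exists k1 : 'I_s, k0 != k1.
  have : (0 < #|predC1 k0|)%N by rewrite cardC1 card_ord; lia.
  by move=> /card_gt0P[k1]; rewrite inE eq_sym => k01; exists k1.
case: k k' => [k|] [k'|].
- have [<-|kk'] := eqVneq k k'.
    have [k1 kk1] := other k; exists k, k1.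
    by rewrite !inE !eqxx !orbT.
  by exists k, k'; rewrite !inE !eqxx !orbT.
- by have [k1 kk1] := other k; exists k, k1; rewrite !inE !eqxx !orbT.
- by have [k1 kk1] := other k'; exists k', k1; rewrite !inE !eqxx !orbT.
- have k0 : 'I_s by exists 0%N; apply: ltn_trans s1.
  by have [k1 kk1] := other k0; exists k0, k1; rewrite !inE !eqxx.
Qed.

Lemma card_set_pairs (I J : finType) (P : I -> J -> bool) :
  #|[set p : I * J | P p.1 p.2]| = (\sum_i #|[set j | P i j]|)%N.
Proof.
rewrite -sum1_card (partition_big fst xpredT) //=; apply: eq_bigr => i _.
rewrite -sum1_card (reindex_onto (fun j => (i, j)) snd) /=.
  by apply: eq_bigl => j; rewrite !inE /= !eqxx !andbT.
by move=> [i' j]; rewrite /= => /andP[_ /eqP->].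
Qed.

Lemma block_count (V B : finType) (r : nat) (bl : B -> 'I_r -> V) (X : {set V}) :
  injective (fun p : B * 'I_r => bl p.1 p.2) ->
  (#|X| + r * #|B| <= (\sum_b #|[set a | bl b a \in X]|) + #|V|)%N.
Proof.
move=> bl_inj.
have imE := card_set_pairs (fun b a => bl b a \in X).
have <- : #|[set: B * 'I_r]| = (r * #|B|)%N.
  by rewrite cardsT card_prod card_ord mulnC.
rewrite -imE -(cardsID [set p : B * 'I_r | bl p.1 p.2 \in X] [set: B * 'I_r]).
rewrite setTI setTD addnCA leq_add2l.
rewrite -(card_imset (mem (~: [set p : B * 'I_r | bl p.1 p.2 \in X])) bl_inj).
rewrite -(cardsC X) leq_add2l; apply: subset_leq_card; apply/subsetP => v.
by move=> /imsetP[p]; rewrite !inE => pX ->.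
Qed.

Lemma sample_bad_rare (R : realType) (r M : nat) (eps : R) :
  (0 < r)%N -> 0 < eps -> eps <= 1 -> exists s0, forall s, (s0 <= s)%N ->
  forall (V B : finType) (bl : B -> 'I_r -> V) (x : V) (X : V -> V -> {set V}),
  injective (fun p : B * 'I_r => bl p.1 p.2) -> (0 < #|B|)%N ->
  r%:R * (#|V|%:R - r%:R * #|B|%:R) <= eps / 2 * #|V|%:R ->
  (M * #|[set t : {ffun 'I_s -> B} | sample_bad bl eps x X t]| <= #|B| ^ s)%N.
Proof.
move=> r0 eps0 eps1.
(* A union bound runs over [(s.+1 * r) ^ 2 <= 4 * r ^ 2 * s ^ 2] pairs of positions. Half of [eps]
   is spent on sampling, half on the vertices outside the blocks. *)
have [||s0 s0P] := @sample_mean R r (4 * r ^ 2 * M) (eps / 2); [lra|lra|].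
exists (maxn s0 2) => s; rewrite geq_max => /andP[s0s s2] V B bl x X bl_inj B0 uV.
pose bad (p : (option 'I_s * 'I_r) * (option 'I_s * 'I_r)) :=
  [set t : {ffun 'I_s -> B} |
     let Y := X (position bl x t p.1) (position bl x t p.2) in
     (sample_count bl x t Y)%:R < s%:R * (r%:R * #|Y|%:R / #|V|%:R - eps)].
have badP p : (4 * r ^ 2 * M * s ^ 2 * #|bad p| <= #|B| ^ s)%N.
  case: p => c c'.
  have [i [i' [ii' ci c'i]]] := two_rows c.1 c'.1 s2.
  pose sel (d : option 'I_s * 'I_r) b b' :=
    if d.1 is Some k then bl (if k == i then b else b') d.2 else x.
  have selE (d : option 'I_s * 'I_r) (t : {ffun 'I_s -> B}) :
      d.1 \in [:: None; Some i; Some i'] ->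
      position bl x t d = sel d (t i) (t i').
    rewrite /position /sel; case: d => -[k|] a //=; rewrite !inE /=.
    case/orP => /eqP[->]; rewrite ?eqxx //.
    by rewrite eq_sym (negbTE ii').
  pose h b b' y := #|[set a | bl y a \in X (sel c b b') (sel c' b b')]|.
  apply: leq_trans (s0P s s0s B i i' h B0 ii' _); last first.
    by move=> b b' y; apply: leq_trans (max_card _) _; rewrite card_ord.
  rewrite leq_mul2l; apply/orP; right; apply: subset_leq_card.
  apply/subsetP => t; rewrite !inE /= (selE c) // (selE c') //.
  set Y := X _ _; move=> lt_t.
  have cnt : (\sum_k h (t i) (t i') (t k) <= sample_count bl x t Y)%N.
    rewrite /h -card_set_pairs.
    pose emb (p : 'I_s * 'I_r) : option 'I_s * 'I_r := (Some p.1, p.2).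
    have emb_inj : injective emb by move=> [k a] [k' a'] [-> ->].
    rewrite -(card_imset _ emb_inj); apply: subset_leq_card.
    apply/subsetP => d /imsetP[p]; rewrite inE => Yp ->.
    by rewrite inE /position.
  have BR : 0 < #|B|%:R :> R by rewrite ltr0n.
  have rR : 0 < r%:R :> R by rewrite ltr0n.
  have VB : r%:R * #|B|%:R <= #|V|%:R :> R.
    rewrite -natrM ler_nat mulnC -[r in (_ * r)%N]card_ord -card_prod.
    exact: leq_card bl_inj.
  have VR : 0 < #|V|%:R :> R by apply: lt_le_trans VB; rewrite mulr_gt0.
  have bc := block_count Y bl_inj.
  have {}bc : #|Y|%:R + r%:R * #|B|%:R <=
      (\sum_y h (t i) (t i') y)%N%:R + #|V|%:R :> R.
    by rewrite -natrM -!natrD ler_nat.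
  apply: le_lt_trans (_ : _ <= (sample_count bl x t Y)%:R) _; first by rewrite ler_nat.
  apply: lt_le_trans lt_t _; rewrite ler_wpM2l //.
  set S := (\sum_y _)%N%:R in bc *.
  have S0 : 0 <= S by rewrite /S.
  suff : r%:R * #|Y|%:R / #|V|%:R - eps / 2 <= S / #|B|%:R by lra.
  rewrite ler_pdivlMr // -(ler_pM2r VR).
  have -> : (r%:R * #|Y|%:R / #|V|%:R - eps / 2) * #|B|%:R * #|V|%:R =
      (r%:R * #|Y|%:R - eps / 2 * #|V|%:R) * #|B|%:R by field; rewrite gt_eqF.
  have h1 : r%:R * #|Y|%:R - eps / 2 * #|V|%:R <= r%:R * S by nra.
  apply: (@le_trans _ _ (r%:R * S * #|B|%:R)); first by rewrite ler_wpM2r.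
  have -> : r%:R * S * #|B|%:R = S * (r%:R * #|B|%:R) by ring.
  exact: ler_wpM2l.
have sub : (#|[set t : {ffun 'I_s -> B} | sample_bad bl eps x X t]| <=
    \sum_p #|bad p|)%N.
  apply: leq_trans (card_bigcup_le _ _); apply: subset_leq_card.
  apply/subsetP => t; rewrite inE => /existsP[c /existsP[c' cc']].
  by apply/bigcupP; exists (c, c') => //; rewrite inE.
have total : (4 * r ^ 2 * s ^ 2 * (M * \sum_p #|bad p|) <=
    (s.+1 * r) ^ 2 * #|B| ^ s)%N.
  have -> : ((s.+1 * r) ^ 2 * #|B| ^ s =
      \sum_(p : (option 'I_s * 'I_r) * (option 'I_s * 'I_r)) #|B| ^ s)%N.
    by rewrite sum_nat_const !card_prod card_option !card_ord mulnn.
  rewrite mulnA big_distrr /=; apply: leq_sum => p _.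
  by apply: leq_trans (badP p); rewrite leq_mul2r; apply/orP; right; nia.
have pos : (0 < 4 * r ^ 2 * s ^ 2)%N by rewrite !muln_gt0; lia.
rewrite -(leq_pmul2l pos); apply: leq_trans (leq_trans total _).
  by rewrite leq_mul2l leq_mul2l sub !orbT.
by rewrite leq_mul2r; apply/orP; right; nia.
Qed.

(** * The sampled graph *)

Definition inner_edges (V : finType) (E : rel V) (S : {set V}) : {set V * V} :=
  [set p | [&& p.1 \in S, p.2 \in S & E p.1 p.2]].

Definition rich (R : realType) (V : finType) (E : rel V) (delta : R)
    (U : {set V}) : {set V} :=
  [set z in U | delta * #|V|%:R <= #|~: nonout E z :&: U|%:R].

Lemma card_inner_edges (V : finType) (E : rel V) (S : {set V}) :
  #|inner_edges E S| = (\sum_(a in S) #|~: nonout E a :&: S|)%N.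
Proof.
have := card_set_pairs (fun a b => [&& a \in S, b \in S & E a b]).
rewrite /inner_edges => ->; rewrite [RHS]big_mkcond /=; apply: eq_bigr => a _.
case: ifP => aS; last first.
  by apply/eqP; rewrite cards_eq0; apply/eqP/setP => b; rewrite !inE.
by apply: eq_card => b; rewrite !inE negbK andTb andbC.
Qed.

Lemma inner_edgesU (V : finType) (E : rel V) (U S : {set V}) : U \subset S ->
  (#|inner_edges E S| <= #|inner_edges E U| + 2 * #|S :\: U| * #|V|)%N.
Proof.
move=> US; pose A := S :\: U.
have sub : inner_edges E S \subset
    inner_edges E U :|: (setX A [set: V] :|: setX [set: V] A).
  apply/subsetP => -[a b]; rewrite !inE /= andbT => /and3P[-> -> ->].
  by case: (a \in U); case: (b \in U).
apply: (leq_trans (subset_leq_card sub)).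
have [h1 _] := leq_card_setU (inner_edges E U) (setX A [set: V] :|: setX [set: V] A).
have [h2 _] := leq_card_setU (setX A [set: V]) (setX [set: V] A).
apply: leq_trans h1 _; rewrite leq_add2l; apply: leq_trans h2 _.
by rewrite !cardsX cardsT -/A -mulnA mul2n -addnn [X in (X + _)%N]mulnC mulnC.
Qed.

(** If [U] falls short of [#|V| / r], a few vertices are added to reach that size. Each accounts for
    at most [2 * #|V|] edges, so [U] itself keeps [gamma / 2 * #|V| ^ 2] edges, and averaging over
    their tails gives rich vertices. *)
Lemma many_rich (R : realType) (V : finType) (E : rel V) (r : nat) (gamma : R)
    (U : {set V}) :
  (1 < r)%N -> 0 < gamma -> 8 <= gamma * #|V|%:R ->
  (forall S : {set V}, (#|V| <= r * #|S|)%N ->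
     gamma * #|V|%:R ^+ 2 < #|inner_edges E S|%:R) ->
  (1 - gamma / 8) * #|V|%:R <= r%:R * #|U|%:R ->
  gamma / 4 * #|V|%:R <= #|rich E (gamma / 4) U|%:R.
Proof.
move=> r1 gamma0 Vlarge dense Ularge; set n := #|V| in Vlarge dense Ularge *.
have n0 : 0 < n%:R :> R by nra.
have r2 : 2 <= r%:R :> R by rewrite (ler_nat _ 2).
have U_edges : gamma / 2 * n%:R ^+ 2 <= #|inner_edges E U|%:R.
  have [nU|Un] := leqP n (r * #|U|).
    by have := dense U nU; have := sqr_ge0 (n%:R : R); nra.
  have [k /andP[nk kn]] : exists k, (n <= r * k <= n + r)%N.
    exists (n %/ r).+1; have := divn_eq n r.
    have : (n %% r < r)%N by rewrite ltn_mod; apply: ltn_trans r1.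
    clear; nia.
  have Uk : (#|U| <= k)%N by nia.
  have kV : (k <= n)%N by nia.
  have [A AU Ak] : exists2 A : {set V}, A \subset ~: U & #|A| = (k - #|U|)%N.
    by apply: subset_of_card; have := cardsC U; rewrite -/n; lia.
  have USA : (U :|: A) :\: U = A.
    apply/setP => v; rewrite !inE; case: (boolP (v \in U)) => //= vU.
    by apply/esym/negP => /(subsetP AU); rewrite inE vU.
  have cardUA : #|U :|: A| = k.
    by rewrite -(cardsID U (U :|: A)) USA Ak (setIidPr (subsetUl U A)) subnKC.
  have := inner_edgesU E (subsetUl U A); rewrite USA Ak -/n.
  have := dense (U :|: A); rewrite cardUA => /(_ nk).
  move=> h1 h2.
  have h3 : #|inner_edges E (U :|: A)|%:R <=
      #|inner_edges E U|%:R + 2 * (k - #|U|)%N%:R * n%:R :> R.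
    by rewrite -!natrM -natrD ler_nat.
  have h4 : (k - #|U|)%N%:R <= 1 + gamma / 16 * n%:R :> R.
    rewrite natrB //.
    have : r%:R * k%:R <= n%:R + r%:R :> R by rewrite -natrM -natrD ler_nat.
    nra.
  nra.
rewrite -(ler_pM2r n0).
have : #|inner_edges E U|%:R <=
    #|rich E (gamma / 4) U|%:R * n%:R + n%:R * (gamma / 4 * n%:R) :> R.
  rewrite card_inner_edges natr_sum (bigID (mem (rich E (gamma / 4) U))) /=.
  apply: lerD.
    rewrite mulr_natl -sumr_const.
    apply: (@le_trans _ _ (\sum_(i in U | i \in rich E (gamma / 4) U) n%:R)).
      by apply: ler_sum => z _; rewrite ler_nat max_card.
    rewrite big_mkcond [X in _ <= X]big_mkcond; apply: ler_sum => z _.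
    by case: ifP => [/andP[_ ->]|_] //; case: ifP.
  apply: (@le_trans _ _ (\sum_(z : V) gamma / 4 * n%:R)); last first.
    by rewrite sumr_const -[X in X <= _]mulr_natl.
  rewrite big_mkcond; apply: ler_sum => z _; case: ifP => [/andP[zU]|_].
    by rewrite !inE zU /= -ltNge => /ltW.
  by rewrite mulr_ge0 ?(ltW n0) // divr_ge0 // ltW.
nra.
Qed.

(* Edges inside a row are dropped: in the blow-up, two vertices of one row may come
   from different blocks, about whose adjacency the sample says nothing. *)
Definition host (V B : finType) (r s : nat) (E : rel V) (bl : B -> 'I_r -> V)
    (x : V) (t : {ffun 'I_s -> B}) : rel (option 'I_s * 'I_r) :=
  fun c c' => (c.1 != c'.1) && E (position bl x t c) (position bl x t c').

Lemma card_row (s r : nat) (k : option 'I_s) :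
  #|[set c : option 'I_s * 'I_r | c.1 == k]| = r.
Proof.
rewrite -[RHS]card_ord -[RHS](card_imset (mem 'I_r) (_ : injective (pair k))).
  apply: eq_card => -[k' a]; rewrite !inE /=; apply/eqP/imsetP => [->|[a' _ []]//].
  by exists a.
by move=> a a' [].
Qed.

Lemma host_card (s r : nat) : #|{: option 'I_s * 'I_r}| = (r * s.+1)%N.
Proof. by rewrite card_prod card_option !card_ord mulnC. Qed.

Lemma sample_countC (V B : finType) (r s : nat) (bl : B -> 'I_r -> V) (x : V)
    (t : {ffun 'I_s -> B}) (X : {set V}) :
  (sample_count bl x t X + sample_count bl x t (~: X) = r * s.+1)%N.
Proof.
rewrite -host_card -(cardsC [set c | position bl x t c \in X]); congr (_ + _)%N.
by apply: eq_card => c; rewrite !inE.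
Qed.

Lemma sample_good (R : realType) (V B : finType) (r s : nat)
    (bl : B -> 'I_r -> V) (eps : R) (x : V) (X : V -> V -> {set V})
    (t : {ffun 'I_s -> B}) c c' :
  ~~ sample_bad bl eps x X t ->
  s%:R * (r%:R * #|X (position bl x t c) (position bl x t c')|%:R / #|V|%:R - eps)
    <= (sample_count bl x t (X (position bl x t c) (position bl x t c')))%:R.
Proof.
rewrite negb_exists => /forallP/(_ c); rewrite negb_exists => /forallP/(_ c').
by rewrite -leNgt.
Qed.

Lemma non_sample_count (R : realType) (V B : finType) (r s : nat)
    (bl : B -> 'I_r -> V) (eps : R) (x : V) (N : V -> {set V})
    (t : {ffun 'I_s -> B}) c :
  (0 < #|V|)%N -> ~~ sample_bad bl eps x (fun y _ => ~: N y) t ->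
  (sample_count bl x t (N (position bl x t c)))%:R <=
    r%:R + s%:R * (r%:R * #|N (position bl x t c)|%:R / #|V|%:R + eps).
Proof.
move=> V0 /(sample_good c c); set y := position bl x t c.
have VR : 0 < #|V|%:R :> R by rewrite ltr0n.
have cN : #|~: N y|%:R = #|V|%:R - #|N y|%:R :> R.
  by rewrite -(cardsC (N y)) natrD; ring.
have cS : (sample_count bl x t (N y))%:R + (sample_count bl x t (~: N y))%:R =
    r%:R * (s%:R + 1) :> R.
  by rewrite -natrD sample_countC natrM -natr1.
rewrite cN (_ : r%:R * (#|V|%:R - #|N y|%:R) / #|V|%:R =
    r%:R - r%:R * #|N y|%:R / #|V|%:R); last by field; rewrite gt_eqF.
lra.
Qed.

Lemma host_nonadjacent_le (V B : finType) (r s : nat) (E : rel V)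
    (bl : B -> 'I_r -> V) (x : V) (t : {ffun 'I_s -> B}) c :
  (#|nonout (host E bl x t) c| <=
     r + sample_count bl x t (nonout E (position bl x t c)))%N /\
  (#|nonin (host E bl x t) c| <=
     r + sample_count bl x t (nonin E (position bl x t c)))%N.
Proof.
have rowE := card_row r c.1; split; rewrite -[X in (X + _)%N]rowE.
  apply: leq_trans (leq_card_setU _ _); apply: subset_leq_card.
  apply/subsetP => c'; rewrite !inE negb_and negbK eq_sym.
  by case: (c'.1 == c.1).
apply: leq_trans (leq_card_setU _ _); apply: subset_leq_card.
apply/subsetP => c'; rewrite !inE negb_and negbK.
by case: (c'.1 == c.1).
Qed.

(** Outside the trace [J] of [U = nonout E y], the set [I] has only positions in the row of [c0]. As
    [J] has hardly more than [s] elements, [J :\: I] is small, so [I] meets every subset of [U] of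
    size at least [gamma / 4 * #|V|] whose share the sample respects. It thus contains a rich [c1]
    and then an out-neighbour [c2] of [c1] in another row, against independence. *)
Lemma host_no_large_independent (R : realType) (V B : finType) (r s q : nat)
    (E : rel V) (bl : B -> 'I_r -> V) (eps gamma : R) (x : V)
    (t : {ffun 'I_s -> B}) (I : {set option 'I_s * 'I_r}) :
  (1 < r)%N -> 0 < gamma -> gamma <= 1 -> 8 <= gamma * #|V|%:R -> 0 < eps ->
  eps <= gamma / 32 -> (q + 3 * r)%:R <= gamma / 16 * s%:R ->
  (forall S : {set V}, (#|V| <= r * #|S|)%N ->
     gamma * #|V|%:R ^+ 2 < #|inner_edges E S|%:R) ->
  (forall y, r%:R * #|nonout E y|%:R <= (1 + eps) * #|V|%:R) ->
  ~~ sample_bad bl eps x (fun y _ => ~: nonout E y) t ->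
  ~~ sample_bad bl eps x (fun y _ => rich E (gamma / 4) (nonout E y)) t ->
  ~~ sample_bad bl eps x (fun y z => ~: nonout E z :&: nonout E y) t ->
  (forall c c', c \in I -> c' \in I -> ~~ host E bl x t c c') ->
  (s.+1 <= #|I| + q)%N -> False.
Proof.
move=> r1 gamma0 gamma1 Vlarge eps0 eps_le q_le dense Eout good_out good_rich good_edge
  Iind Ilarge.
have n0 : 0 < #|V|%:R :> R by nra.
have V0 : (0 < #|V|)%N by rewrite -(ltr0n R).
have r2 : 2 <= r%:R :> R by rewrite (ler_nat _ 2).
have qE : (q + 3 * r)%:R = q%:R + 3 * r%:R :> R by rewrite natrD natrM.
have q0 : 0 <= q%:R :> R by [].
have s0 : 0 < s%:R :> R.
  by rewrite -(@pmulr_rgt0 _ (gamma / 16)); [lra | rewrite divr_gt0].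
have Ilarge' : s%:R + 1 <= #|I|%:R + q%:R :> R.
  by rewrite natr1 -natrD ler_nat.
have [c0 c0I] : exists c0, c0 \in I.
  apply/set0Pn; rewrite -card_gt0 -(ltr0n R); nra.
set y := position bl x t c0.
pose U := nonout E y; pose J := [set c | position bl x t c \in U].
have JE : #|J| = sample_count bl x t U by [].
have := non_sample_count c0 V0 good_out; rewrite -/y -/U -JE => J_le.
pose p : R := r%:R * #|U|%:R / #|V|%:R.
rewrite -/p in J_le.
have p_le : p <= 1 + eps by rewrite ler_pdivrMr //; apply: Eout.
have indep c c' : c \in I -> c' \in I -> position bl x t c' \notin
    nonout E (position bl x t c) -> c'.1 == c.1.
  move=> cI c'I; have := Iind c c' cI c'I.
  by rewrite /host !inE negb_and !negbK eq_sym => /orP[->//|/negbTE->].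
have I_row : (#|I :\: J| <= r)%N.
  rewrite -[X in (_ <= X)%N](card_row r c0.1); apply: subset_leq_card; apply/subsetP => c.
  rewrite in_setD [c \in J]in_set => /andP[cJ cI].
  by rewrite in_set; apply: indep.
have IJ : (#|I| <= #|J :&: I| + r)%N.
  by rewrite -(cardsID J I) setIC leq_add2l.
have JI : #|J :\: I|%:R <= 2 * r%:R + q%:R + 2 * eps * s%:R :> R.
  have : #|J|%:R = #|J :&: I|%:R + #|J :\: I|%:R :> R by rewrite -natrD cardsID.
  have : #|I|%:R <= #|J :&: I|%:R + r%:R :> R by rewrite -natrD ler_nat.
  nra.
have Ularge : (1 - gamma / 8) * #|V|%:R <= r%:R * #|U|%:R.
  rewrite -ler_pdivlMr // -/p -(ler_pM2r s0).
  have : #|J :&: I|%:R <= #|J|%:R :> R by rewrite ler_nat subset_leq_card ?subsetIl.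
  have : #|I|%:R <= #|J :&: I|%:R + r%:R :> R by rewrite -natrD ler_nat.
  nra.
have large (X : {set V}) : gamma / 4 * #|V|%:R <= #|X|%:R ->
    2 * r%:R + q%:R + 2 * eps * s%:R + r%:R <
    s%:R * (r%:R * #|X|%:R / #|V|%:R - eps).
  move=> Xlarge; have : gamma / 2 <= r%:R * #|X|%:R / #|V|%:R.
    by rewrite ler_pdivlMr //; nra.
  nra.
have Rlarge := many_rich r1 gamma0 Vlarge dense Ularge.
have := sample_good c0 c0 good_rich; rewrite -/y -/U => cntR.
have [c1 c1I c1R] : exists2 c1, c1 \in I &
    position bl x t c1 \in rich E (gamma / 4) U.
  apply/exists_inP; apply: contraT; rewrite negb_exists_in => /forall_inP noR.
  have : (sample_count bl x t (rich E (gamma / 4) U) <= #|J :\: I|)%N.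
    apply: subset_leq_card; apply/subsetP => c.
    rewrite [c \in [set _ | _]]in_set => cR; rewrite in_setD [c \in J]in_set.
    have -> : position bl x t c \in U by move: cR; rewrite in_set => /andP[].
    by rewrite andbT; apply: contraL cR => cI; apply: noR.
  rewrite -(ler_nat R); have := large _ Rlarge; lra.
have := c1R; rewrite in_set => /andP[c1U c1rich].
have := sample_good c0 c1 good_edge; rewrite -/y -/U => cntX.
have [c2 c2I /andP[c2row c2X]] : exists2 c2, c2 \in I & (c2.1 != c1.1) &&
    (position bl x t c2 \in ~: nonout E (position bl x t c1) :&: U).
  apply/exists_inP; apply: contraT; rewrite negb_exists_in => /forall_inP noX.
  have : (sample_count bl x t (~: nonout E (position bl x t c1) :&: U) <=
      #|J :\: I| + r)%N.
    rewrite -[X in (_ + X)%N](card_row r c1.1).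
    apply: leq_trans (leq_card_setU _ _); apply: subset_leq_card.
    apply/subsetP => c; rewrite [c \in [set _ | _]]in_set => cX.
    rewrite in_setU in_setD [c \in J]in_set [X in _ || X]in_set.
    have /setIP[_ ->] := cX; rewrite andbT.
    case: (boolP (c \in I)) => //= cI.
    by have := noX c cI; rewrite cX andbT negbK.
  rewrite -(ler_nat R) natrD; have := large _ c1rich; lra.
by move: c2row; rewrite (indep c1 c2) //; case/setIP: c2X; rewrite inE.
Qed.

(** * Tiling the blow-up *)

Local Open Scope nat_scope.

Definition embedding (r : nat) (V : finType) (E : rel V) (T : rel 'I_r)
    (f : {ffun 'I_r -> V}) : Prop :=
  injective f /\ forall i j, T i j -> E (f i) (f j).

Definition disjoint_images (r : nat) (V : finType)
    (Q : {set {ffun 'I_r -> V}}) : Prop :=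
  forall f g a b, f \in Q -> g \in Q -> f a = g b -> f = g.

Lemma card_ord_lt (n k : nat) : k <= n -> #|[set i : 'I_n | i < k]| = k.
Proof.
move=> kn; rewrite -[RHS]card_ord.
rewrite -(card_imset (mem 'I_k) (_ : injective (widen_ord kn))); last first.
  by move=> i j /(congr1 val) /= ij; apply: val_inj.
apply: eq_card => i; rewrite inE; apply/idP/imsetP => [ik|[j _ ->]];
  last exact: (ltn_ord j).
by exists (Ordinal ik) => //; apply: val_inj.
Qed.

Lemma nat_relE (r : nat) (T : rel 'I_r) (i j : 'I_r) : nat_rel T i j = T i j.
Proof. by rewrite /nat_rel !valK. Qed.

(** Each copy [f] is taken [y f] times. Exactly [D] of these pass through a given [c], and the one
    of rank [d] in a fixed enumeration receives [slot c d], so no two tiles collide. *)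
Lemma fractional_tiling_blowup (r D : nat) (C V : finType) (H : rel C) (E : rel V)
    (T : rel 'I_r) (y : {ffun 'I_r -> C} -> nat) (slot : C -> nat -> V) :
  0 < r -> irreflexive H -> (forall i j, i != j -> T i j (+) T j i) ->
  fractional_tiling H (nat_rel T) D y ->
  (forall c c' d d', d < D -> d' < D -> slot c d = slot c' d' -> c = c' /\ d = d') ->
  (forall c c' d d', d < D -> d' < D -> H c c' -> E (slot c d) (slot c' d')) ->
  exists Q : {set {ffun 'I_r -> V}},
    [/\ forall f, f \in Q -> embedding E T f, disjoint_images Q,
        r * #|Q| = #|C| * D &
        forall f a, f \in Q -> exists c d, d < D /\ f a = slot c d].
Proof.
move=> r0 Hirr Txor [ycopy ysum] slot_inj slot_edge.
pose Y := \sum_f y f.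
have yY f : y f <= Y by rewrite /Y (bigD1 f) //= leq_addr.
pose A := [set p : {ffun 'I_r -> C} * 'I_Y | p.2 < y p.1].
have A_edge (p : {ffun 'I_r -> C} * 'I_Y) i j : p \in A -> T i j ->
    H (p.1 i) (p.1 j).
  rewrite inE => pA Tij; apply: ycopy; first by apply: leq_ltn_trans pA.
  by rewrite nat_relE.
have A_inj (p : {ffun 'I_r -> C} * 'I_Y) : p \in A -> injective p.1.
  move=> pA i j pij; apply/eqP; apply: contraT => ij.
  have [Tij|Tij] := boolP (T i j).
    by have := A_edge p i j pA Tij; rewrite pij Hirr.
  have Tji : T j i by have := Txor i j ij; rewrite (negbTE Tij).
  by have := A_edge p j i pA Tji; rewrite pij Hirr.
pose inc c := [set p in A | c \in codom p.1].
have card_inc c : #|inc c| = D.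
  rewrite -(ysum c).
  have := card_set_pairs (fun (f : {ffun 'I_r -> C}) (k : 'I_Y) =>
    (k < y f) && (c \in codom f)).
  have -> : [set p : {ffun 'I_r -> C} * 'I_Y | (p.2 < y p.1) && (c \in codom p.1)]
      = inc c by apply/setP => p; rewrite !inE.
  move=> ->; apply: eq_bigr => f _.
  have [cf|cf] := boolP (c \in codom f); last first.
    rewrite (_ : [set i | f i == c] = set0) ?cards0 ?muln0; last first.
      apply/setP => i; rewrite !inE; apply: contraNF cf => /eqP <-.
      exact: codom_f.
    by apply/eqP; rewrite cards_eq0; apply/eqP/setP => k; rewrite !inE andbF.
  have -> : [set k : 'I_Y | (k < y f) && true] = [set k : 'I_Y | k < y f].
    by apply/setP => k; rewrite !inE andbT.
  rewrite card_ord_lt //; case: (posnP (y f)) => [->|yf]; first by rewrite mul0n.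
  rewrite -[LHS]muln1; congr (_ * _); apply/esym/eqP/cards1P.
  have /codomP[i ci] := cf; exists i; apply/setP => j; rewrite !inE.
  have Y0 : 0 < Y by apply: leq_trans (yY f).
  have fA : (f, Ordinal Y0) \in A by rewrite inE /=.
  by rewrite ci; apply/eqP/eqP => [/(A_inj _ fA)|->].
pose rank (p : {ffun 'I_r -> C} * 'I_Y) c := index p (enum (inc c)).
have rank_lt p a : p \in A -> rank p (p.1 a) < D.
  move=> pA; rewrite /rank -(card_inc (p.1 a)) cardE index_mem mem_enum.
  by rewrite inE pA codom_f.
pose tile (p : {ffun 'I_r -> C} * 'I_Y) :=
  [ffun a => slot (p.1 a) (rank p (p.1 a))].
have tile_inj p p' a a' : p \in A -> p' \in A -> tile p a = tile p' a' ->
    p = p' /\ p.1 a = p'.1 a'.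
  move=> pA p'A; rewrite !ffunE => /slot_inj[]; try exact: rank_lt.
  move=> cc' ranks; split=> //; rewrite /rank -cc' in ranks.
  have inE1 : p \in enum (inc (p.1 a)) by rewrite mem_enum inE pA codom_f.
  have inE2 : p' \in enum (inc (p.1 a)) by rewrite mem_enum inE p'A cc' codom_f.
  by rewrite -(nth_index p inE1) ranks nth_index.
exists (tile @: A); split.
- move=> _ /imsetP[p pA ->]; split.
    by move=> a a' /(tile_inj p p a a' pA pA)[_ /(A_inj p pA)].
  by move=> i j Tij; rewrite !ffunE; apply: slot_edge; rewrite ?rank_lt //; apply: A_edge.
- move=> _ _ a b /imsetP[p pA ->] /imsetP[p' p'A ->].
  by move=> /(tile_inj p p' a b pA p'A)[->].
- rewrite card_in_imset; last first.
    move=> p p' pA p'A tpp'; have := tile_inj p p' (Ordinal r0) (Ordinal r0) pA p'A.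
    by rewrite tpp' => /(_ erefl)[].
  have -> : #|A| = \sum_f y f.
    have := card_set_pairs (fun (f : {ffun 'I_r -> C}) (k : 'I_Y) => k < y f).
    by rewrite /A => ->; apply: eq_bigr => f _; rewrite card_ord_lt.
  rewrite -sum_nat_const (eq_bigr (fun c => \sum_f y f * #|[set i | f i == c]|)).
    rewrite exchange_big /= big_distrr /=; apply: eq_bigr => f _.
    rewrite -big_distrr /= mulnC; congr (_ * _).
    rewrite -[LHS]card_ord -sum1_card (partition_big f xpredT) //=.
    by apply: eq_bigr => c _; rewrite -sum1_card; apply: eq_bigl => i; rewrite inE.
  by move=> c _; rewrite ysum.
- move=> _ a /imsetP[p pA ->]; exists (p.1 a), (rank p (p.1 a)).
  by rewrite ffunE rank_lt.
Qed.

Local Open Scope ring_scope.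

(** * Perfect fractional tilings of good samples *)

Definition slope (r : nat) : nat := ((2 * r + 1) * (slack r 1 + r))%N.

Lemma slackE (r e : nat) : (slack r e + r * e = (slack r 1 + r) * e)%N.
Proof. by rewrite /slack muln1 mulnDl. Qed.

(** The choices give [eps * s = e / 4], so that, with [4 * r <= e], sampling errors, clones and
    dropped rows together stay within [e]. They also give [gamma / 16 * s = (slope r + 3 * r) * e],
    which lets [host_no_large_independent] absorb the deficit [slope r * e] of the independent
    set. *)
Lemma host_tiling (R : realType) (V B : finType) (r g e : nat)
    (Q := (16 * g * (slope r + 3 * r))%N) (s := (Q * e)%N)
    (gamma := 1 / g%:R : R) (eps := 1 / (4 * Q%:R) : R)
    (E : rel V) (T : rel 'I_r) (bl : B -> 'I_r -> V) (x : V)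
    (t : {ffun 'I_s -> B}) :
  (1 < r)%N -> (0 < g)%N -> (4 * r <= e)%N -> (8 * g <= #|V|)%N ->
  tournament_on (nat_rel T) r ->
  (forall S : {set V}, (#|V| <= r * #|S|)%N ->
     gamma * #|V|%:R ^+ 2 < #|inner_edges E S|%:R) ->
  (forall y, r%:R * #|nonout E y|%:R <= (1 + eps) * #|V|%:R) ->
  (forall y, r%:R * #|nonin E y|%:R <= (1 + eps) * #|V|%:R) ->
  ~~ sample_bad bl eps x (fun y _ => ~: nonout E y) t ->
  ~~ sample_bad bl eps x (fun y _ => ~: nonin E y) t ->
  ~~ sample_bad bl eps x (fun y _ => rich E (gamma / 4) (nonout E y)) t ->
  ~~ sample_bad bl eps x (fun y z => ~: nonout E z :&: nonout E y) t ->
  exists D (y : {ffun 'I_r -> option 'I_s * 'I_r} -> nat),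
    (0 < D)%N /\ fractional_tiling (host E bl x t) (nat_rel T) D y.
Proof.
move=> r1 g0 re Vg Ttour dense Eout Ein good_out good_in good_rich good_edge.
have Q0 : (0 < Q)%N by rewrite /Q !muln_gt0 g0 /=; lia.
have QR : 0 < Q%:R :> R by rewrite ltr0n.
have gR : 0 < g%:R :> R by rewrite ltr0n.
have V0 : (0 < #|V|)%N by lia.
have VR : 0 < #|V|%:R :> R by rewrite ltr0n.
have eps_s : eps * s%:R = e%:R / 4.
  by rewrite /eps /s natrM; field; rewrite gt_eqF.
have gamma_s : gamma / 16 * s%:R = ((slope r + 3 * r) * e)%N%:R.
  by rewrite /gamma /s /Q !natrM; field; rewrite gt_eqF.
have re' : 4 * r%:R <= e%:R :> R by rewrite -natrM ler_nat.
have bound (N : V -> {set V}) c :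
    (forall y, r%:R * #|N y|%:R <= (1 + eps) * #|V|%:R) ->
    ~~ sample_bad bl eps x (fun y _ => ~: N y) t ->
    (r + sample_count bl x t (N (position bl x t c)) <= s.+1 + e)%N.
  move=> Ndeg /(non_sample_count c V0); set cnt := sample_count _ _ _ _.
  have := Ndeg (position bl x t c); rewrite -ler_pdivrMr //.
  set p := _ / _ => p_le cnt_le.
  have s0 : 0 <= s%:R :> R by [].
  rewrite -(ler_nat R) !natrD -natr1; nra.
case: (@fractional_tiling_or_independent _ (host E bl x t) (nat_rel T) r s.+1 e).
- by [].
- exact: host_card.
- by [].
- move=> c; have [h _] := host_nonadjacent_le E bl x t c.
  by apply: (leq_trans h); apply: bound.
- move=> c; have [_ h] := host_nonadjacent_le E bl x t c.
  by apply: (leq_trans h); apply: bound.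
- rewrite slackE ltnS /s leq_mul2r; apply/orP; right.
  by rewrite /Q /slope; nia.
- by [].
move=> [I [Iind]]; rewrite slackE mulnA -/(slope r) => Ilarge; exfalso.
apply: (@host_no_large_independent R V B r s (slope r * e) E bl eps gamma x t I
  r1 _ _ _ _ _ _ dense Eout good_out good_rich good_edge Iind Ilarge).
- by rewrite /gamma divr_gt0.
- by rewrite /gamma ler_pdivrMr // mul1r (ler_nat _ 1).
- by rewrite /gamma mul1r ler_pdivlMl // mulrC -natrM ler_nat.
- by rewrite /eps divr_gt0 // mulr_gt0.
- rewrite /eps /gamma ler_pdivrMr ?mulr_gt0 //.
  have -> : 1 / g%:R / 32 * (4 * Q%:R) = Q%:R / (8 * g%:R) :> R.
    by field; rewrite gt_eqF.
  rewrite ler_pdivlMr ?mulr_gt0 // mul1r -natrM ler_nat /Q; nia.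
- rewrite gamma_s ler_nat mulnDl leq_add2l; nia.
Qed.

(** * Selecting the blow-up of a single sample *)

Lemma noninjective_rare (B : finType) (s : nat) :
  (#|[set t : {ffun 'I_s -> B} | ~~ injectiveb t]| * #|B| <= s ^ 2 * #|B| ^ s)%N.
Proof.
pose coll (p : 'I_s * 'I_s) :=
  [set t : {ffun 'I_s -> B} | (p.1 != p.2) && (t p.1 == t p.2)].
have collP p : (#|coll p| * #|B| <= #|B| ^ s)%N.
  case: p => i i'.
  (* Overwriting coordinate [i'] by an arbitrary value loses nothing: the old value is still visible
     at [i]. *)
  pose upd (q : {ffun 'I_s -> B} * B) := [ffun k => if k == i' then q.2 else q.1 k].
  rewrite -[X in (_ * X)%N]cardsT -cardsX -(card_in_imset (f := upd)).
    by apply: leq_trans (max_card _) _; rewrite card_ffun card_ord.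
  move=> [t b] [t' b']; rewrite !inE /= !andbT.
  move=> /andP[ii' /eqP tii] /andP[_ /eqP tii'] /ffunP eq_upd.
  have tt' k : k != i' -> t k = t' k.
    by move=> ki'; have := eq_upd k; rewrite !ffunE /= (negbTE ki').
  congr (_, _); last by have := eq_upd i'; rewrite !ffunE /= eqxx.
  apply/ffunP => k; have [->|/tt'//] := eqVneq k i'.
  by rewrite -tii -tii' tt'.
have sub : (#|[set t : {ffun 'I_s -> B} | ~~ injectiveb t]| <= \sum_p #|coll p|)%N.
  apply: leq_trans (card_bigcup_le _ _); apply: subset_leq_card.
  apply/subsetP => t; rewrite inE => /injectivePn[i [i' ii' tii']].
  by apply/bigcupP; exists (i, i') => //; rewrite inE /= ii' tii' eqxx.
apply: (@leq_trans (\sum_p #|coll p| * #|B|)).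
  by rewrite -big_distrl leq_mul2r sub orbT.
have -> : (s ^ 2 * #|B| ^ s = \sum_(p : 'I_s * 'I_s) #|B| ^ s)%N.
  by rewrite sum_nat_const card_prod card_ord mulnn.
by apply: leq_sum => p _; apply: collP.
Qed.

Local Open Scope nat_scope.

(** [L] has constant size, so it cannot be one more part in the box theorem. It is treated first: a
    popular colour is fixed, [common_subset] is applied to [L] at a constant loss, and the box is
    found among the common tuples. *)
Lemma monochromatic_box (K : finType) (s D D' : nat) :
  0 < #|K| -> 0 < D -> 0 < D' -> exists N, forall (V B : finType) (L : {set V})
    (good : V -> {ffun 'I_s -> B} -> bool) (col : V -> {ffun 'I_s -> B} -> K),
  #|L| = 2 * (4 * #|K|) * D' -> N <= #|B| ->
  (forall x, #|B| ^ s <= 4 * #|[set t | good x t]|) ->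
  exists (c : K) (X : {set V}) (W : 'I_s -> {set B}),
    [/\ X \subset L, #|X| = D', forall k, #|W k| = D &
      forall x (t : {ffun 'I_s -> B}), x \in X -> (forall k, t k \in W k) ->
        good x t /\ col x t = c].
Proof.
move=> K0 D0 D'0; set q := 4 * #|K|.
have q0 : 0 < q by rewrite muln_gt0.
have [|N NP] := @box_in_dense s (2 * q * 2 ^ (2 * q * D')) D _ D0.
  by rewrite muln_gt0 expn_gt0 [0 < 2 * q]muln_gt0 q0.
exists N => V B L good col Lcard NB many.
pose P c x t := good x t && (col x t == c).
have [c cP] : exists c, #|L| * #|{ffun 'I_s -> B}| <=
    q * \sum_(x in L) #|[set t | P c x t]|.
  apply/existsP; apply: contraT; rewrite negb_exists => /forallP few.
  have : \sum_(c : K) q * \sum_(x in L) #|[set t | P c x t]| <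
      \sum_(c : K) #|L| * #|{ffun 'I_s -> B}|.
    have /card_gt0P[c0 _] := K0.
    rewrite (bigD1 c0) //= [X in _ < X](bigD1 c0) //= -addSn leq_add //.
      by rewrite ltnNge few.
    by apply: leq_sum => c _; apply: ltnW; rewrite ltnNge few.
  rewrite sum_nat_const -big_distrr /= exchange_big /= ltnNge => /negP[].
  apply: (@leq_trans (#|K| * (4 * \sum_(x in L) \sum_c #|[set t | P c x t]|)));
    last by rewrite mulnA [#|K| * 4]mulnC.
  rewrite leq_mul2l; apply/orP; right.
  rewrite -sum_nat_const big_distrr /=; apply: leq_sum => x _.
  rewrite card_ffun card_ord; apply: (leq_trans (many x)); rewrite leq_mul2l /=.
  rewrite -sum1_card (partition_big (col x) xpredT) //=; apply: leq_sum => c _.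
  by rewrite -sum1_card; apply: eq_leq; apply: eq_bigl => t; rewrite !inE.
have [|//|//|X [XL XD' XZ]] := @common_subset V {ffun 'I_s -> B} L (P c) q D' q0.
  by rewrite Lcard.
rewrite Lcard card_ffun card_ord in XZ.
have [W [WD WP]] := NP B _ NB XZ.
exists c, X, W; split=> // x t xX tW.
have := WP t tW; rewrite inE => /forall_inP/(_ x xX)/andP[gx /eqP cx].
by split.
Qed.

(** A largest family works: [r] further vertices outside [L] would form another block. Keeping [L]
    out of the blocks separates the two kinds of slots in the blow-up. *)
Lemma extend_blocks (r : nat) (V : finType) (P : {set {ffun 'I_r -> V}})
    (L : {set V}) :
  0 < r -> (forall f, f \in P -> injective f) -> disjoint_images P ->
  (forall f a, f \in P -> f a \notin L) ->
  exists F : {set {ffun 'I_r -> V}},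
    [/\ P \subset F, forall f, f \in F -> injective f, disjoint_images F,
        forall f a, f \in F -> f a \notin L & #|V| <= #|L| + r * #|F| + r].
Proof.
move=> r0 Pinj Pdisj PL.
pose ok (F : {set {ffun 'I_r -> V}}) := [/\ P \subset F,
  forall f, f \in F -> injective f, disjoint_images F &
  forall f a, f \in F -> f a \notin L].
have okP : `[< ok P >] by apply/asboolP.
case: (@arg_maxnP _ P (fun F => `[< ok F >]) (fun F => #|F|) okP).
move=> F /asboolP[PF Finj Fdisj FL] Fmax; exists F; split=> //.
pose ev (p : {ffun 'I_r -> V} * 'I_r) := p.1 p.2.
pose cov := ev @: setX F [set: 'I_r].
have cov_le : #|cov| <= r * #|F|.
  by apply: leq_trans (leq_imset_card _ _) _; rewrite cardsX cardsT card_ord mulnC.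
rewrite leqNgt; apply/negP => Vlarge.
have Zlarge : r <= #|~: (L :|: cov)|.
  have := cardsC (L :|: cov); have [h _] := leq_card_setU L cov.
  lia.
have [Z ZL Zr] := subset_of_card Zlarge.
have [v0 v0Z] : exists v0, v0 \in Z by apply/set0Pn; rewrite -card_gt0 Zr.
pose f := [ffun a : 'I_r => nth v0 (enum Z) a].
have fZ a : f a \in Z by rewrite ffunE -mem_enum mem_nth // -cardE Zr.
have fout a : f a \notin L /\ f a \notin cov.
  by have := subsetP ZL _ (fZ a); rewrite !in_setC in_setU negb_or => /andP.
have f_cov g a b : g \in F -> f a = g b -> False.
  move=> gF fg; have [_ /negP] := fout a; apply.
  by rewrite fg; apply/imsetP; exists (g, b); rewrite // inE /= gF inE.
have fF : f \notin F by apply/negP => /f_cov/(_ (erefl (f (Ordinal r0)))).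
have : `[< ok (f |: F) >].
  apply/asboolP; split.
  - by apply: (subset_trans PF); apply: subsetUr.
  - move=> g /setU1P[->|/Finj//] a b; rewrite !ffunE => /eqP.
    by rewrite nth_uniq ?enum_uniq -?cardE ?Zr // => /eqP/val_inj.
  - move=> g h a b /setU1P[->|gF] /setU1P[->|hF] //.
    + by move=> /f_cov -/(_ hF).
    + by move=> /esym/f_cov -/(_ gF).
    + exact: Fdisj.
  - by move=> g a /setU1P[->|/FL//]; have [] := fout a.
by move=> /Fmax; rewrite /= cardsU1 fF add1n ltnn.
Qed.

Local Open Scope ring_scope.

(** * Improving a packing *)

Definition packing (r : nat) (V : finType) (E : rel V) (T : rel 'I_r)
    (P : {set {ffun 'I_r -> V}}) : Prop :=
  (forall f, f \in P -> embedding E T f) /\ disjoint_images P.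

Lemma replace_tiles (r : nat) (V : finType) (E : rel V) (T : rel 'I_r)
    (P R Q : {set {ffun 'I_r -> V}}) :
  (0 < r)%N -> packing E T P -> packing E T Q -> (#|R| < #|Q|)%N ->
  (forall f g a b, f \in Q -> g \in P -> f a = g b -> g \in R) ->
  exists P', packing E T P' /\ (#|P| < #|P'|)%N.
Proof.
move=> r0 [Pemb Pdisj] [Qemb Qdisj] RQ meet; exists ((P :\: R) :|: Q); split.
  split=> [f /setUP[/setDP[/Pemb//]|/Qemb//]|f g a b].
  move=> /setUP[/setDP[fP fR]|fQ] /setUP[/setDP[gP gR]|gQ].
  - exact: Pdisj.
  - by move=> /esym/(meet _ _ _ _ gQ fP); rewrite (negbTE fR).
  - by move=> /(meet _ _ _ _ fQ gP); rewrite (negbTE gR).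
  - exact: Qdisj.
have -> : #|P :\: R :|: Q| = (#|P :\: R| + #|Q|)%N.
  rewrite cardsU (_ : _ :&: Q = set0) ?cards0 ?subn0 //.
  apply/setP => f; rewrite !inE; apply/negP => /andP[/andP[fR fP] fQ].
  by have := meet f f (Ordinal r0) (Ordinal r0) fQ fP erefl; rewrite (negbTE fR).
have := cardsID R P; have := subset_leq_card (subsetIr P R); lia.
Qed.

Definition covered_by (r : nat) (V : finType) (P : {set {ffun 'I_r -> V}}) : {set V} :=
  [set v | [exists f in P, exists a, f a == v]].

(** A single [N] is least order, inverse of the relative degree error and bound on the leftover;
    [1 / g] stands for gamma. *)
Lemma packing_or_sparse_set (R : realType) (r g : nat) :
  (1 < r)%N -> (0 < g)%N -> exists N, forall (V : finType) (E : rel V) (T : rel 'I_r),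
  irreflexive E -> irreflexive T -> (forall i j, i != j -> T i j (+) T j i) ->
  (N <= #|V|)%N ->
  (forall y, N * (r * #|nonout E y|) <= N.+1 * #|V|)%N ->
  (forall y, N * (r * #|nonin E y|) <= N.+1 * #|V|)%N ->
  (exists P, packing E T P /\ (#|~: covered_by P| <= N)%N) \/
  (exists S : {set V}, (#|V| <= r * #|S|)%N /\
     (g * #|inner_edges E S| <= #|V| ^ 2)%N).
Proof.
move=> r1 g0; have r0 : (0 < r)%N by apply: ltnW.
pose Q := (16 * g * (slope r + 3 * r))%N.
pose gamma := 1 / g%:R : R; pose eps := 1 / (4 * Q%:R) : R.
have Q0 : (0 < Q)%N by rewrite /Q !muln_gt0 g0 /=; lia.
have QR : 0 < Q%:R :> R by rewrite ltr0n.
have Q1 : 1 <= Q%:R :> R by rewrite (ler_nat _ 1).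
have eps0 : 0 < eps by rewrite divr_gt0 ?mulr_gt0.
have eps1 : eps <= 1 by rewrite ler_pdivrMr ?mulr_gt0 //; lra.
(* Five events can spoil a sample: four of the kind [sample_bad], and a repeated block. With a share
   of at most 1/8 each, they leave more than the 1/4 required by [monochromatic_box]. *)
have [s0 bad_rare] := sample_bad_rare 8 r0 eps0 eps1.
pose e := (4 * r + s0)%N; pose s := (Q * e)%N.
have s0s : (s0 <= s)%N by rewrite /s /e; nia.
pose C := (option 'I_s * 'I_r)%type.
have [D [D0 denomP]] := uniform_denominator r C.
pose K : finType := {ffun C * C -> bool}.
have K0 : (0 < #|K|)%N by apply/card_gt0P; exists [ffun=> true].
have rD0 : (0 < r * D)%N by rewrite muln_gt0 r0.
have [N1 boxP] := monochromatic_box s K0 D0 rD0.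
pose l := (2 * (4 * #|K|) * (r * D))%N.
(* The terms ensure in turn: enough blocks for the box theorem and for rare repetitions, after
   [l + r] vertices are set aside; a distortion of densities by these vertices of at most [eps / 2];
   the order asked for by [host_tiling]; and [1 / N <= eps]. *)
pose N := (r * (N1 + 8 * s ^ 2 + 1) + l + r + 8 * Q * (r * (l + r)) + 8 * g + 4 * Q)%N.
exists N => V E T Eirr Tirr Txor VN Nout Nin.
have [[S [Slarge Ssparse]]|dense] := EM (exists S : {set V},
  (#|V| <= r * #|S|)%N /\ (g * #|inner_edges E S| <= #|V| ^ 2)%N).
  by right; exists S.
left.
have {}dense (S : {set V}) : (#|V| <= r * #|S|)%N ->
     gamma * #|V|%:R ^+ 2 < #|inner_edges E S|%:R.
  move=> Slarge; rewrite /gamma mulrAC mul1r ltr_pdivrMr ?ltr0n // -natrM -natrX ltr_nat.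
  by rewrite ltnNge mulnC; apply/negP => h; apply: dense; exists S.
have Ttour : tournament_on (nat_rel T) r.
  split=> [i|i j ir jr ij].
    by rewrite /nat_rel; case: insubP => [i' _ _|//]; rewrite Tirr.
  by rewrite -[i]/(val (Ordinal ir)) -[j]/(val (Ordinal jr)) !nat_relE; apply: Txor.
have degR (M : V -> {set V}) : (forall y, N * (r * #|M y|) <= N.+1 * #|V|)%N ->
    forall y, r%:R * #|M y|%:R <= (1 + eps) * #|V|%:R.
  move=> h y; have {}h : N%:R * (r%:R * #|M y|%:R) <= (N%:R + 1) * #|V|%:R :> R.
    by rewrite natr1 -!natrM ler_nat.
  have NR : 4 * Q%:R <= N%:R :> R by rewrite -natrM ler_nat /N; lia.
  have N0 : 0 < N%:R :> R by lra.
  rewrite -(ler_pM2l N0); apply: (le_trans h); rewrite mulrA ler_wpM2r //.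
  rewrite mulrDr mulr1 lerD2l /eps mul1r ler_pdivlMr ?mulr_gt0 ?mul1r //.
have [P [Ppack Pmax]] : exists P, packing E T P /\
    forall P', packing E T P' -> (#|P'| <= #|P|)%N.
  have pack0 : `[< packing E T set0 >].
    by apply/asboolP; split=> [f|f h a b]; rewrite inE.
  case: (@arg_maxnP _ set0 (fun P => `[< packing E T P >]) (fun P => #|P|) pack0).
  move=> P /asboolP Ppack Pmax; exists P; split=> // P' P'pack.
  by apply: Pmax; apply/asboolP.
exists P; split=> //; rewrite leqNgt; apply/negP => left_large.
have lN : (l <= #|~: covered_by P|)%N.
  by apply: leq_trans (ltnW left_large); rewrite /N; lia.
have [L LP Ll] := subset_of_card lN.
have PL f a : f \in P -> f a \notin L.
  move=> fP; apply/negP => /(subsetP LP); rewrite !inE => /negP; apply.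
  by apply/exists_inP; exists f => //; apply/existsP; exists a.
have [F [PF Finj Fdisj FL Fcard]] :=
  extend_blocks r0 (fun f fP => (Ppack.1 f fP).1) Ppack.2 PL.
pose B : finType := {f : {ffun 'I_r -> V} | f \in F}.
pose bl (b : B) (a : 'I_r) := val b a.
have BF : #|B| = #|F| by rewrite card_sig.
rewrite Ll -BF in Fcard.
have bl_inj : injective (fun p : B * 'I_r => bl p.1 p.2).
  move=> [b a] [b' a'] /= eq_bl.
  have bb' : b = b' by apply: val_inj; apply: (Fdisj _ _ _ _ (valP b) (valP b') eq_bl).
  move: eq_bl; rewrite bb' => /(Finj _ (valP b')) -> //.
have B_large : (N1 + 8 * s ^ 2 + 1 <= #|B|)%N.
  rewrite -(leq_pmul2l r0); move: VN Fcard; rewrite /N; clear; lia.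
have uncov : r%:R * (#|V|%:R - r%:R * #|B|%:R) <= eps / 2 * #|V|%:R :> R.
  have h1 : #|V|%:R - r%:R * #|B|%:R <= (l + r)%N%:R :> R.
    by rewrite lerBlDr -natrM -natrD ler_nat addnC addnA [(r * _ + l)%N]addnC.
  apply: (@le_trans _ _ (r%:R * (l + r)%N%:R)); first by rewrite ler_wpM2l.
  have -> : eps / 2 * #|V|%:R = #|V|%:R / (8 * Q%:R).
    by rewrite /eps; field; rewrite gt_eqF.
  rewrite ler_pdivlMr ?mulr_gt0 // -!natrM ler_nat.
  move: VN; rewrite /N; clear; lia.
have B0 : (0 < #|B|)%N by clear -B_large; lia.
pose X1 y (_ : V) := ~: nonout E y.
pose X2 y (_ : V) := ~: nonin E y.
pose X3 y (_ : V) := rich E (gamma / 4) (nonout E y).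
pose X4 y z := ~: nonout E z :&: nonout E y.
pose good x (t : {ffun 'I_s -> B}) := [&& injectiveb t, ~~ sample_bad bl eps x X1 t,
  ~~ sample_bad bl eps x X2 t, ~~ sample_bad bl eps x X3 t &
  ~~ sample_bad bl eps x X4 t].
pose col x (t : {ffun 'I_s -> B}) : K := [ffun p => host E bl x t p.1 p.2].
have many x : (#|B| ^ s <= 4 * #|[set t | good x t]|)%N.
  pose bad Y := [set t : {ffun 'I_s -> B} | sample_bad bl eps x Y t].
  pose goods := [set t : {ffun 'I_s -> B} | good x t].
  pose coll := [set t : {ffun 'I_s -> B} | ~~ injectiveb t].
  have rare Y : (8 * #|bad Y| <= #|B| ^ s)%N :=
    bad_rare s s0s V B bl x Y bl_inj B0 uncov.
  have noninj : (8 * #|coll| <= #|B| ^ s)%N.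
    have h := noninjective_rare B s; rewrite -(leq_pmul2l B0).
    have sB : (8 * s ^ 2 <= #|B|)%N by clear -B_large; lia.
    apply: (@leq_trans (8 * s ^ 2 * #|B| ^ s)); last by rewrite leq_mul2r sB orbT.
    by rewrite mulnCA [(#|B| * _)%N]mulnC -mulnA leq_mul2l h orbT.
  have arith (p m n0 n1 n2 n3 n4 : nat) :
      (8 * n0 <= p -> 8 * n1 <= p -> 8 * n2 <= p -> 8 * n3 <= p -> 8 * n4 <= p ->
       p <= m + (n0 + (n4 + (n3 + (n2 + n1)))) -> p <= 4 * m)%N.
    by clear; lia.
  apply: arith noninj (rare X1) (rare X2) (rare X3) (rare X4) _.
  have -> : (#|B| ^ s = #|[set: {ffun 'I_s -> B}]|)%N.
    by rewrite cardsT card_ffun card_ord.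
  apply: (@leq_trans
    #|goods :|: (coll :|: (bad X4 :|: (bad X3 :|: (bad X2 :|: bad X1))))|).
    apply: subset_leq_card; apply/subsetP => t _; rewrite !inE /good.
    by case: injectiveb; case: sample_bad; case: sample_bad; case: sample_bad;
       case: sample_bad.
  by do 5 (apply: (leq_trans (leq_card_setU _ _)); rewrite leq_add2l).
have [|c [X [W [XL Xcard Wcard mono]]]] := boxP V B L good col Ll _ many;
  first by clear -B_large; lia.
have [x0 x0X] : exists x, x \in X by apply/set0Pn; rewrite -card_gt0 Xcard.
have /card_gt0P[b0 _] := B0.
pose wsel k d := nth b0 (enum (W k)) d.
have wselP k d : (d < D)%N -> wsel k d \in W k.
  by move=> dD; rewrite -mem_enum mem_nth // -cardE Wcard.
pose xsel (a : 'I_r) d := nth x0 (enum X) (a * D + d)%N.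
have xsel_lt (a : 'I_r) d : (d < D)%N -> (a * D + d < size (enum X))%N.
  move=> dD; rewrite -cardE Xcard; have := ltn_ord a; clear -dD; nia.
have xselP a d : (d < D)%N -> xsel a d \in X.
  by move=> dD; rewrite -mem_enum mem_nth // xsel_lt.
pose cf : {ffun C * C -> bool} := c.
have mono_host x (t : {ffun 'I_s -> B}) : x \in X -> (forall k, t k \in W k) ->
    forall c1 c2, host E bl x t c1 c2 = cf (c1, c2).
  by move=> xX tW c1 c2; have [_ cE] := mono x t xX tW; rewrite /cf -cE ffunE.
pose t0 : {ffun 'I_s -> B} := [ffun k => wsel k 0%N].
have t0W k : t0 k \in W k by rewrite ffunE wselP.
pose H : rel C := fun c1 c2 => cf (c1, c2).
have Hhost : host E bl x0 t0 = H.
  by apply/funext => c1; apply/funext => c2; rewrite mono_host.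
have [y tiling_y] : exists y : {ffun 'I_r -> C} -> nat,
    fractional_tiling H (nat_rel T) D y.
  apply: denomP; rewrite -Hhost.
  have [/and5P[_ good1 good2 good3 good4] _] := mono x0 t0 x0X t0W.
  apply: (@host_tiling R) good1 good2 good3 good4 => //.
  - by rewrite leq_addr.
  - by apply: leq_trans VN; rewrite /N; clear; lia.
  - exact: degR Nout.
  - exact: degR Nin.
pose slot (c1 : C) d := if c1.1 is Some k then bl (wsel k d) c1.2 else xsel c1.2 d.
have bl_notin_L b a : bl b a \notin L by apply: FL (valP b).
(* A block shared by two of the sets would put a tuple with a repeated entry into the box, whose
   tuples are all good and hence injective. *)
have W_disj k k' b : b \in W k -> b \in W k' -> k = k'.
  move=> bk bk'.
  pose t : {ffun 'I_s -> B} := [ffun j => if (j == k) || (j == k') then b else t0 j].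
  have tW j : t j \in W j.
    rewrite ffunE; have [->//|_] := eqVneq j k; have [->//|_] := eqVneq j k'.
    exact: t0W.
  have [/andP[/injectiveP tinj _] _] := mono x0 t x0X tW.
  by apply: tinj; rewrite !ffunE !eqxx orbT.
have slot_inj c1 c2 d1 d2 : (d1 < D)%N -> (d2 < D)%N -> slot c1 d1 = slot c2 d2 ->
    c1 = c2 /\ d1 = d2.
  move=> d1D d2D; case: c1 c2 => [[k|] a] [[k'|] a']; rewrite /slot /=.
  - move=> /(bl_inj (_, _) (_, _))[wk <-].
    have kk' : k = k'.
      by apply: (W_disj k k' (wsel k d1)); [|rewrite wk]; apply: wselP.
    split; first by rewrite kk'.
    move: wk; rewrite kk' => /eqP.
    by rewrite nth_uniq ?enum_uniq -?cardE ?Wcard // => /eqP.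
  - move=> h; have := bl_notin_L (wsel k d1) a.
    by rewrite h (subsetP XL) // xselP.
  - move=> h; have := bl_notin_L (wsel k' d2) a'.
    by rewrite -h (subsetP XL) // xselP.
  - move=> /eqP; rewrite nth_uniq ?enum_uniq ?xsel_lt // => /eqP aD.
    have aa' : a = a' :> nat.
      have := congr1 (fun m => (m %/ D)%N) aD; rewrite !divnMDl // !divn_small //.
      by rewrite !addn0.
    rewrite -(val_inj aa'); split=> //; move: aD; rewrite aa'.
    by move=> /addnI.
have slot_edge c1 c2 d1 d2 : (d1 < D)%N -> (d2 < D)%N -> H c1 c2 ->
    E (slot c1 d1) (slot c2 d2).
  move=> d1D d2D.
  (* Adjacent positions lie in different rows, so one sample from the box can realize both chosen
     slots at once, and its host is [H] like that of every other. *)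
  pose t : {ffun 'I_s -> B} :=
    [ffun k => if c1.1 == Some k then wsel k d1 else wsel k d2].
  pose x := if c1.1 is None then xsel c1.2 d1 else xsel c2.2 d2.
  have tW k : t k \in W k by rewrite ffunE; case: ifP => _; apply: wselP.
  have xX : x \in X by rewrite /x; case: (c1.1) => [k|]; apply: xselP.
  rewrite /H -(mono_host x t xX tW) /host => /andP[].
  rewrite /position /slot /x /t.
  case: c1 c2 {x t tW xX} => [[k|] a] [[k'|] a'] //=; rewrite ?ffunE ?eqxx //.
  by move=> /negbTE->.
have [Qn [Qemb Qdisj Qcard Qslot]] : exists Q : {set {ffun 'I_r -> V}},
    [/\ forall f, f \in Q -> embedding E T f, disjoint_images Q,
        (r * #|Q| = #|{: option 'I_s * 'I_r}| * D)%N &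
        forall f a, f \in Q -> exists c d, (d < D)%N /\ f a = slot c d].
  apply: (fractional_tiling_blowup r0 _ Txor tiling_y slot_inj slot_edge).
  by move=> c1; rewrite -Hhost /host eqxx.
have {}Qcard : #|Qn| = (s.+1 * D)%N.
  by apply/eqP; rewrite -(eqn_pmul2l r0) Qcard host_card mulnA.
pose removed := [set val b | b in \bigcup_k W k].
have removed_card : (#|removed| <= s * D)%N.
  apply: (leq_trans (leq_imset_card _ _)); apply: (leq_trans (card_bigcup_le _ _)).
  by rewrite (eq_bigr (fun=> D)) // sum_nat_const card_ord.
have [||f h a b fQ hP fh|P' [P'pack]] :=
    @replace_tiles r V E T P removed Qn r0 Ppack.
- by split.
- rewrite Qcard mulSn; apply: (leq_ltn_trans removed_card).
  by rewrite -[X in (X < _)%N]add0n ltn_add2r.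
- have [[[k|] a'] [d [dD fa]]] := Qslot f a fQ.
    apply/imsetP; exists (wsel k d); first by apply/bigcupP; exists k => //; apply: wselP.
    by apply: (Fdisj _ _ b a' (subsetP PF _ hP) (valP (wsel k d))); rewrite -fh fa.
  have := PL h b hP; rewrite -fh fa /slot /= (subsetP XL) //; exact: xselP.
- by rewrite ltnNge Pmax.
Qed.

(** * The theorem *)

Lemma hierarchy_fun_id (R : realType) : hierarchy_fun (fun x : R => x).
Proof. by split. Qed.

(** Prefix sums make [b] monotone, the summand [x] makes [F] strictly increasing, and reciprocals on
    both sides turn its growth into a small increasing function. *)
Lemma hierarchy_fun_below (R : realType) (b : nat -> nat) :
  exists f : R -> R, hierarchy_fun f /\
    forall x, 0 < x -> f x <= 1 / (b (Num.truncn (1 / x))).+1%:R.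
Proof.
pose S k := (\sum_(0 <= j < k.+1) b j)%N.
pose F (x : R) := x + (S (Num.truncn x)).+1%:R.
have F0 x : 0 < x -> 0 < F x by move=> x0; rewrite addr_gt0.
have S_mono k k' : (k <= k')%N -> (S k <= S k')%N.
  by move=> kk'; rewrite /S (big_cat_nat (n := k.+1) (p := k'.+1)) //= leq_addr.
exists (fun x => 1 / F (1 / x)); split; first split.
- by move=> x x0; rewrite divr_gt0 // F0 // divr_gt0.
- move=> x y x0 xy; have y0 := lt_trans x0 xy.
  have yx : y^-1 < x^-1 by rewrite ltf_pV2.
  rewrite !div1r ltf_pV2 ?posrE ?F0 ?invr_gt0 // ltr_leD //.
  by rewrite ler_nat ltnS S_mono // le_truncn // ltW.
- move=> x x0; have x'0 : 0 < 1 / x by rewrite divr_gt0.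
  rewrite [leLHS]div1r [leRHS]div1r lef_pV2 ?posrE ?F0 //.
  apply: (@le_trans _ _ (S (Num.truncn (1 / x))).+1%:R).
    by rewrite ler_nat ltnS /S big_nat_recr //= leq_addl.
  by rewrite /F lerDr ltW.
Qed.

Lemma bigminn_le (I : eqType) (s : seq I) (F : I -> nat) (n : nat) (i : I) :
  i \in s -> (\big[minn/n]_(j <- s) F j <= F i)%N.
Proof.
elim: s => [//|j s IHs]; rewrite inE big_cons => /orP[/eqP->|/IHs h].
  exact: geq_minl.
exact: leq_trans (geq_minr _ _) h.
Qed.

Lemma min_semidegree_le (G : digraph) (x : G) :
  (min_semidegree G <= outdeg x)%N /\ (min_semidegree G <= indeg x)%N.
Proof.
have := bigminn_le (fun y : G => minn (outdeg y) (indeg y)) (num_vertices G)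
  (mem_index_enum x).
rewrite -/(min_semidegree G) => h.
by split; apply: leq_trans h _; [apply: geq_minl|apply: geq_minr].
Qed.

Lemma packing_relabel (T G : digraph) (r : nat) (rank : T -> 'I_r)
    (lab : 'I_r -> T) (P : {set {ffun 'I_r -> G}}) :
  cancel rank lab -> cancel lab rank ->
  packing (@edge G) (fun i j => edge (lab i) (lab j)) P ->
  exists P' : {set {ffun T -> G}}, is_packing P' /\
    ~: covered P' \subset ~: covered_by P.
Proof.
move=> rankK labK [Pemb Pdisj].
pose relabel (f : {ffun 'I_r -> G}) : {ffun T -> G} := [ffun v => f (rank v)].
exists (relabel @: P); split; first split.
- move=> _ /imsetP[f fP ->]; have [finj fedge] := Pemb f fP; split.
    by move=> u v; rewrite !ffunE => /finj/(can_inj rankK).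
  by move=> u v uv; rewrite !ffunE; apply: fedge; rewrite !rankK.
- move=> _ _ /imsetP[f fP ->] /imsetP[h hP ->] fh.
  rewrite disjoint_subset; apply/subsetP => v /imsetP[u _ ->].
  rewrite inE; apply/negP => /imsetP[u' _]; rewrite !ffunE => fhu.
  by rewrite (Pdisj f h _ _ fP hP fhu) eqxx in fh.
- rewrite setCS; apply/subsetP => v; rewrite inE => /exists_inP[f fP].
  move=> /existsP[a /eqP <-]; apply/bigcupP; exists (relabel f).
    exact: imset_f.
  by apply/imsetP; exists (lab a); rewrite // ffunE labK.
Qed.

Theorem theorem5p3 (R : realType) :
  exists f1 f2 f3 f4 : R -> R,
    [/\ hierarchy_fun f1, hierarchy_fun f2, hierarchy_fun f3
      & hierarchy_fun f4] /\
    forall (n l r : nat) (eps gamma : R),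
      (3 <= r)%N ->
      0 < gamma -> gamma <= f1 (1 / r%:R) ->
      0 < eps -> eps <= f2 gamma ->
      0 < 1 / l%:R :> R -> 1 / l%:R <= f3 eps ->
      0 < 1 / n%:R :> R -> 1 / n%:R <= f4 (1 / l%:R) ->
      forall T : digraph, num_vertices T = r -> is_tournament T ->
      forall G : digraph, num_vertices G = n ->
      (1 - 1 / r%:R - eps) * n%:R <= (min_semidegree G)%:R ->
      (exists P : {set {ffun T -> G}},
          is_packing P /\ (#|~: covered P| <= l)%N) \/
      (exists S : {set G},
          gamma_independent gamma S /\ n%:R / r%:R <= #|S|%:R :> R).
Proof.
pose good (p : nat * nat) N := (1 < p.1)%N -> (0 < p.2)%N ->
  forall (V : finType) (E : rel V) (T : rel 'I_p.1),
  irreflexive E -> irreflexive T -> (forall i j, i != j -> T i j (+) T j i) ->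
  (N <= #|V|)%N ->
  (forall y, N * (p.1 * #|nonout E y|) <= N.+1 * #|V|)%N ->
  (forall y, N * (p.1 * #|nonin E y|) <= N.+1 * #|V|)%N ->
  (exists P, packing E T P /\ (#|~: covered_by P| <= N)%N) \/
  (exists S : {set V}, (#|V| <= p.1 * #|S|)%N /\
     (p.2 * #|inner_edges E S| <= #|V| ^ 2)%N).
have [Nf Nfgood] : {Nf : nat * nat -> nat & forall p, good p (Nf p)}.
  apply: choice => -[r g].
  have [[r1 g0]|no] := EM ((1 < r)%N /\ (0 < g)%N).
    have [N NP] := packing_or_sparse_set R r1 g0.
    by exists N => _ _; apply: NP.
  by exists 0%N => r1 g0; case: no.
(* Here [k] is the integer part of [1 / gamma], so [1 / k.+1] is below gamma, and the sum covers
   every possible [r]. The factor [r] is there because non-neighbourhoods satisfy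
   [r * #|M| <= n + eps * r * n]. *)
pose b k := (\sum_(r < k.+1) Nf (val r, k.+1) * r)%N.
have [f2 [f2_hier f2_le]] := @hierarchy_fun_below R b.
(* The bound N depends on r and gamma only, and r <= 1 / gamma; hence f2 alone can
   enforce 1 / n <= 1 / l <= eps <= 1 / (N r). *)
exists id, f2, id, id; split; first by split=> //; exact: hierarchy_fun_id.
move=> n l r eps gamma r3 gamma0 gamma_le eps0 eps_le l0 l_le n0 n_le.
move=> T Tr Ttour G Gn deg.
have rR : 0 < r%:R :> R by rewrite ltr0n; apply: leq_trans r3.
have lR : 0 < l%:R :> R by move: l0; rewrite div1r invr_gt0.
have nR : 0 < n%:R :> R by move: n0; rewrite div1r invr_gt0.
pose k := Num.truncn (1 / gamma); pose N := Nf (r, k.+1).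
have rk : (r <= k)%N.
  rewrite truncn_ge_nat; last by rewrite divr_ge0 // ltW.
  by move: gamma_le; rewrite ler_pdivlMr // ler_pdivlMr // mulrC.
have gamma_k : 1 / k.+1%:R <= gamma.
  rewrite ler_pdivrMr ?ltr0n // mulrC -ler_pdivrMr // ltW //.
  exact: truncnS_gt.
have eps_b : eps * (N * r)%N.+1%:R <= 1.
  have : eps <= 1 / (b k).+1%:R by apply: le_trans eps_le _; apply: f2_le.
  rewrite ler_pdivlMr ?ltr0n // => /(le_trans _); apply.
  rewrite ler_pM2l // ler_nat ltnS /b.
  by rewrite (bigD1 (Ordinal (rk : (r < k.+1)%N))) //= leq_addr.
have Nrl : ((N * r).+1 <= l)%N.
  rewrite -(ler_nat R) -(ler_pM2l eps0); apply: (le_trans eps_b).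
  by move: l_le; rewrite ler_pdivrMr.
have Nl : (N <= l)%N by apply: leq_trans Nrl; rewrite leqW // leq_pmulr // -(ltr0n R).
have ln : (l <= n)%N.
  by move: n_le; rewrite !div1r lef_pV2 ?posrE // ler_nat.
have cardG : #|G| = n by rewrite -Gn /num_vertices cardsT.
have cardT : #|T| = r by rewrite -Tr /num_vertices cardsT.
pose rank (v : T) : 'I_r := cast_ord cardT (enum_rank v).
pose lab (i : 'I_r) : T := enum_val (cast_ord (esym cardT) i).
have rankK : cancel rank lab by move=> v; rewrite /lab /rank cast_ordK enum_rankK.
have labK : cancel lab rank by move=> i; rewrite /lab /rank enum_valK cast_ordKV.
have few (M : {set G}) d : (#|M| + d = n)%N -> (min_semidegree G <= d)%N ->
    (N * (r * #|M|) <= N.+1 * n)%N.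
  move=> Md dmin; rewrite -(ler_nat R) !natrM -natr1.
  have Md' : #|M|%:R + d%:R = n%:R :> R by rewrite -natrD Md.
  have dmin' : (min_semidegree G)%:R <= d%:R :> R by rewrite ler_nat.
  have h : r%:R * #|M|%:R <= n%:R + eps * r%:R * n%:R :> R.
    have : (1 - 1 / r%:R - eps) * n%:R * r%:R <= d%:R * r%:R :> R.
      by rewrite ler_pM2r // (le_trans deg).
    have -> : (1 - 1 / r%:R - eps) * n%:R * r%:R =
        r%:R * n%:R - n%:R - eps * r%:R * n%:R :> R by field; rewrite gt_eqF.
    nra.
  apply: (le_trans (ler_wpM2l (ler0n _ N) h)).
  rewrite mulrDr mulrDl mul1r lerD2l !mulrA.
  rewrite -[leRHS]mul1r ler_wpM2r ?(ltW nR) //.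
  apply: le_trans eps_b; rewrite -natr1 natrM; have := ltW eps0; lra.
have := Nfgood (r, k.+1) (ltnW r3 : (1 < r)%N) isT G (@edge G)
  (fun i j => edge (lab i) (lab j)) (@edge_irr G) _ _ _ _ _.
case.
- by move=> i; rewrite edge_irr.
- by move=> i j ij; apply: Ttour; rewrite (can_eq labK).
- by rewrite cardG; apply: leq_trans ln.
- move=> y; rewrite cardG; apply: (few _ (outdeg y));
    last by have [] := min_semidegree_le y.
  rewrite /outdeg -cardG -(cardsC [set z | edge y z]) addnC; congr (_ + _)%N.
  by apply: eq_card => z; rewrite !inE.
- move=> y; rewrite cardG; apply: (few _ (indeg y));
    last by have [] := min_semidegree_le y.
  rewrite /indeg -cardG -(cardsC [set z | edge z y]) addnC; congr (_ + _)%N.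
  by apply: eq_card => z; rewrite !inE.
- move=> [P [Ppack Pcov]]; left.
  have [P' [P'pack sub]] := packing_relabel rankK labK Ppack.
  exists P'; split=> //; apply: leq_trans (subset_leq_card sub) _.
  exact: leq_trans Pcov Nl.
- move=> [S [Slarge Ssparse]]; right; exists S; split.
    rewrite /gamma_independent Gn; apply: (@le_trans _ _ (1 / k.+1%:R * n%:R ^+ 2)).
      rewrite mulrAC mul1r ler_pdivlMr ?ltr0n // mulrC -natrX -natrM ler_nat.
      by rewrite -cardG.
    by rewrite ler_wpM2r // exprn_ge0.
  by rewrite ler_pdivrMr // -natrM ler_nat mulnC -cardG.
Qed.
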